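(* Let $K$ be a number field, let $N$ be a positive integer, and let $\boldsymbol\epsilon=\{\epsilon_1,\ldots,\epsilon_r\}$ be a system of fundamental units in $K$. There is a constant $k$, depending only on $N$, $K$ and $\boldsymbol\epsilon$, such that for any choice of nonzero ideals $\mathfrak a_1,\ldots,\mathfrak a_h$ of $\mathcal O_K$ representing the distinct ideal classes of $\mathcal O_K$, the search space $\mathcal S(B)$ (defined using $\boldsymbol\epsilon$ and $\mathfrak a_1,\ldots,\mathfrak a_h$) satisfies \[\limsup_{B\to\infty}\frac{\#\mathcal S(B)}{\#\Omega(B)}\le k.\]
   Context: Let $n=[K:\mathbb Q]$, let $\mathcal O_K$ be the ring of integers, and let $\mathrm N(\mathfrak a)$ denote the norm of an ideal $\mathfrak a$. For each place $v$ of $K$, let $|\cdot|_v$ be the absolute value extending one of the standard absolute values of $\mathbb Q$, let $n_v=[K_v:\mathbb Q_v]$ be the local degree, and $\|x\|_v=|x|_v^{n_v}$. Write $v|\infty$ for archimedean places; for such $v$, $\sigma_v:K\to K_v\in\{\mathbb R,\mathbb C\}$ is the corresponding embedding, so $\|x\|_v=|\sigma_v(x)|^{n_v}$ with $n_v=1$ or $2$. Height: for $P=[x_0,\ldots,x_N]\in\mathbb P^N(K)$, $H_K(P)=\prod_v\max\{\|x_0\|_v,\ldots,\|x_N\|_v\}$, the product being over all places $v$ of $K$. For real $B\ge1$, $\Omega(B)=\{P\in\mathbb P^N(K):H_K(P)\le B\}$. Units: $r$ is the rank of $\mathcal O_K^{*}$, and $\Lambda:K^*\to\prod_{v|\infty}\mathbb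 R$ is given by $\Lambda(x)=(\log\|x\|_v)_v$. A system of fundamental units is a collection $\boldsymbol\epsilon=\{\epsilon_1,\ldots,\epsilon_r\}\subset\mathcal O_K^*$ such that $\Lambda(\epsilon_1),\ldots,\Lambda(\epsilon_r)$ form a $\mathbb Z$-basis of the lattice $\Lambda(\mathcal O_K^* )$. Put $F(\boldsymbol\epsilon)=\{t_1\Lambda(\epsilon_1)+\cdots+t_r\Lambda(\epsilon_r):|t_j|\le1/2\text{ for all }j\}$ and $D_v=\max_{\eta\in F(\boldsymbol\epsilon)}\eta_v$ for $v|\infty$ (when $r=0$, $F(\boldsymbol\epsilon)=\{0\}$ and $D_v=0$). Search space: for a nonzero ideal $\mathfrak a$ of $\mathcal O_K$ and $B\ge 1$, let $\mathcal C(\mathfrak a,B)$ be the set of all $x\in\mathfrak a$ such that $|\sigma_v(x)|\le(B\cdot\mathrm N(\mathfrak a))^{1/n}\exp(D_v/n_v)$ for all $v|\infty$ and $|N_{K/\mathbb Q}(x)|\le B\cdot\mathrm N(\mathfrak a)$. Let $\mathcal S(\mathfrak a,B)=\{[x_0,\ldots,x_N]\in\mathbb P^N(K):x_i\in\mathcal C(\mathfrak a,B)\text{ for all }i\}$ (tuples not all zero), and $\mathcal S(B)=\bigcup_{i=1}^h\mathcal S(\mathfrak a_i,B)$. *)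

(* Defs.v *)
From HB Require Import structures.
From mathcomp Require Import all_boot all_order all_algebra all_field.
From mathcomp Require Import finmap.
From mathcomp Require Import all_classical all_reals all_analysis.
Set Implicit Arguments.
Unset Strict Implicit.
Unset Printing Implicit Defensive.
Import Order.TTheory GRing.Theory Num.Theory.
Import numFieldNormedType.Exports.
Local Open Scope classical_set_scope.
Local Open Scope ring_scope.

(* A place of K is represented by its normalized absolute value, the one whose
   restriction to Q is a standard absolute value; this is a bijection with
   equivalence classes of nontrivial absolute values. *)

Definition is_absval (R : realType) (K : fieldType) (v : K -> R) : Prop :=
  [/\ forall x, 0 <= v x,
      forall x, v x = 0 <-> x = 0,
      forall x y, v (x * y) = v x * v y
    & forall x y, v (x + y) <= v x + v y].

Definition padic_abs (R : realType) (p : nat) (q : rat) : R :=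
  if q == 0 then 0
  else p%:R ^ ((logn p `|denq q|%N)%:Z - (logn p `|numq q|%N)%:Z).

Definition arch_place (R : realType) (K : fieldExtType rat) (v : K -> R) : Prop :=
  is_absval v /\ forall q : rat, v q%:A = `|ratr q|.

Definition finite_place (R : realType) (K : fieldExtType rat) (v : K -> R) : Prop :=
  is_absval v /\
  exists p : nat, prime p /\ forall q : rat, v q%:A = padic_abs R p q.

Definition places (R : realType) (K : fieldExtType rat) : set (K -> R) :=
  [set v | arch_place v \/ finite_place v].
Arguments places : clear implicits.

(* The completion K_v is the set of [v_cauchy] sequences of K modulo [v_null]
   sequences, with K embedded as the constant sequences, so that the absolute
   value of K_v restricts to v on K; and Q_v is the completion of Q for the
   restriction of v, i.e. the subfield of classes of rational sequences.
   [local_basis v b] says that the classes of b_0, ..., b_(d-1) form a basis of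
   K_v as a vector space over Q_v. *)

Definition v_cauchy (R : realType) (K : fieldType) (v : K -> R) (u : nat -> K) : Prop :=
  forall e : R, 0 < e -> exists M : nat, forall i j : nat,
    (M <= i)%N -> (M <= j)%N -> v (u i - u j) < e.

Definition v_null (R : realType) (K : fieldType) (v : K -> R) (u : nat -> K) : Prop :=
  forall e : R, 0 < e -> exists M : nat, forall i : nat, (M <= i)%N -> v (u i) < e.

Definition local_basis (R : realType) (K : fieldExtType rat) (v : K -> R)
    (d : nat) (b : 'I_d -> nat -> K) : Prop :=
  [/\ forall i, v_cauchy v (b i),
      forall u : nat -> K, v_cauchy v u ->
        exists2 q : 'I_d -> nat -> rat,
          forall i, v_cauchy v (fun k => (q i k)%:A)
        & v_null v (fun k => u k - \sum_(i < d) (q i k)%:A * b i k)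
    & forall q : 'I_d -> nat -> rat,
        (forall i, v_cauchy v (fun k => (q i k)%:A)) ->
        v_null v (fun k => \sum_(i < d) (q i k)%:A * b i k) ->
        forall i, v_null v (fun k => (q i k)%:A)].

Definition local_degree (R : realType) (K : fieldExtType rat) (v : K -> R) : nat :=
  xget 0%N [set d | exists b : 'I_d -> nat -> K, local_basis v b].

Definition norm_v (R : realType) (K : fieldExtType rat) (v : K -> R) (x : K) : R :=
  v x ^+ local_degree v.

(* A point of P^N(K) is a line of K^(N+1); [x_0, ..., x_N] is the line spanned
   by a nonzero row vector x. *)

Definition proj_point (K : fieldExtType rat) (N : nat) (x : 'rV[K]_N.+1) :
  {vspace 'rV[K]_N.+1} := <[x]>%VS.

(* The product has finite support, and it depends only on the point spanned by
   x by the product formula. *)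
Definition height (R : realType) (K : fieldExtType rat) (N : nat)
    (x : 'rV[K]_N.+1) : R :=
  \big[*%R/1]_(v \in places R K) \big[Num.max/0]_(i < N.+1) norm_v v (x 0 i).
Arguments height R {K N} x.

Definition Omega (R : realType) (K : fieldExtType rat) (N : nat) (B : R) :
    set {vspace 'rV[K]_N.+1} :=
  [set proj_point x | x in [set x : 'rV[K]_N.+1 | x != 0 /\ height R x <= B]].
Arguments Omega {R} K N B.

Definition ring_of_integers (K : fieldExtType rat) : set K :=
  [set x | integralOver (intr : int -> K) x].
Arguments ring_of_integers : clear implicits.

Definition nonzero_ideal (K : fieldExtType rat) (a : set K) : Prop :=
  [/\ a `<=` ring_of_integers K,
      a 0,
      forall x y, a x -> a y -> a (x + y),
      forall c x, ring_of_integers K c -> a x -> a (c * x)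
    & exists2 x, a x & x != 0].

(* O_K / a is finite for a nonzero; on infinite sets [fset_set] is the junk
   value empty. *)
Definition ideal_norm (K : fieldExtType rat) (a : set K) : nat :=
  #|` fset_set [set [set y | a (y - x)] | x in ring_of_integers K] |.

Definition ideal_equiv (K : fieldExtType rat) (a b : set K) : Prop :=
  exists2 c : K, c != 0 & b = [set c * x | x in a].

Definition ideal_class_reps (K : fieldExtType rat) (h : nat) (a : 'I_h -> set K) : Prop :=
  [/\ forall i, nonzero_ideal (a i),
      forall i j, ideal_equiv (a i) (a j) -> i = j
    & forall b, nonzero_ideal b -> exists i, ideal_equiv b (a i)].

Definition field_norm (K : fieldExtType rat) (x : K) : rat :=
  \det (passmx.mxof (vbasis {:K}) (vbasis {:K}) (amulr x)).

Definition is_unit (K : fieldExtType rat) (u : K) : Prop :=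
  [/\ u != 0, ring_of_integers K u & ring_of_integers K u^-1].

Definition indep_units (K : fieldExtType rat) (m : nat) (u : 'I_m -> K) : Prop :=
  (forall i, is_unit (u i)) /\
  forall c : 'I_m -> int, \prod_(i < m) u i ^ c i = 1 -> forall i, c i = 0.

(* The r is unique, and exists by the finite generation of the unit group. *)
Definition unit_rank (K : fieldExtType rat) : nat :=
  xget 0%N [set r | (exists u : 'I_r -> K, indep_units u) /\
                    ~ (exists u : 'I_r.+1 -> K, indep_units u)].

Definition arch_places (R : realType) (K : fieldExtType rat) : Type :=
  {v : K -> R | arch_place v}.

(* On K^*; the value at x = 0 is a convention and is never used. *)
Definition Lambda (R : realType) (K : fieldExtType rat) (x : K) : arch_places R K -> R :=
  fun v => ln (norm_v (sval v) x).
Arguments Lambda R {K} x v.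

Definition fundamental_units (R : realType) (K : fieldExtType rat)
    (eps : 'I_(unit_rank K) -> K) : Prop :=
  [/\ forall j, is_unit (eps j),
      forall u, is_unit u -> exists m : 'I_(unit_rank K) -> int,
        Lambda R u = \sum_j Lambda R (eps j) *~ m j
    & forall m : 'I_(unit_rank K) -> int,
        \sum_j Lambda R (eps j) *~ m j = 0 -> forall j, m j = 0].
Arguments fundamental_units R {K} eps.

Definition fund_domain (R : realType) (K : fieldExtType rat)
    (eps : 'I_(unit_rank K) -> K) : set (arch_places R K -> R) :=
  [set \sum_j t j *: Lambda R (eps j) |
    t in [set t : 'I_(unit_rank K) -> R | forall j, `|t j| <= 2^-1]].
Arguments fund_domain R {K} eps.

(* The supremum is a maximum, since [fund_domain] is compact. *)
Definition Dmax (R : realType) (K : fieldExtType rat)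
    (eps : 'I_(unit_rank K) -> K) (v : arch_places R K) : R :=
  sup [set eta v | eta in fund_domain R eps].

(* [sval v x] is |sigma_v(x)|, as sigma_v is the embedding of K into its
   completion K_v, whose absolute value extends v. *)
Definition search_coords (R : realType) (K : fieldExtType rat)
    (eps : 'I_(unit_rank K) -> K) (a : set K) (B : R) : set K :=
  [set x | [/\ a x,
    forall v : arch_places R K,
      sval v x <= (B * (ideal_norm a)%:R) `^ ((\dim {:K})%:R^-1)
                  * expR (Dmax eps v / (local_degree (sval v))%:R)
    & `|ratr (field_norm x)| <= B * (ideal_norm a)%:R]].

Definition search_space_ideal (R : realType) (K : fieldExtType rat) (N : nat)
    (eps : 'I_(unit_rank K) -> K) (a : set K) (B : R) : set {vspace 'rV[K]_N.+1} :=
  [set proj_point x | x in [set x : 'rV[K]_N.+1 |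
    x != 0 /\ forall i, search_coords eps a B (x 0 i)]].
Arguments search_space_ideal {R K} N eps a B.

Definition search_space (R : realType) (K : fieldExtType rat) (N : nat)
    (eps : 'I_(unit_rank K) -> K) (h : nat) (a : 'I_h -> set K) (B : R) :
    set {vspace 'rV[K]_N.+1} :=
  \bigcup_(i in [set: 'I_h]) search_space_ideal N eps (a i) B.
Arguments search_space {R K} N eps {h} a B.

(* Main.v *)
Require Import Defs.
From HB Require Import structures.
From mathcomp Require Import all_boot all_order all_algebra all_field.
From mathcomp Require Import all_classical all_reals all_analysis.
From mathcomp Require Import complex.
From mathcomp Require Import perm finmap ring lra zify.
Set Implicit Arguments.
Unset Strict Implicit.
Unset Printing Implicit Defensive.
Import Order.TTheory GRing.Theory Num.Theory.
Import numFieldNormedType.Exports.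
Local Open Scope classical_set_scope.
Local Open Scope ring_scope.

(** Put n = [K : Q] and let sigma_1, ..., sigma_n be the embeddings of K in R[i].
    Both counts have the order of magnitude B^(N+1): for B large, each S(a_i, B)
    has at most C B^(N+1) points and Omega(B) has at least c B^(N+1) points, where
    C and c do not depend on the ideals.  The number h of ideals is the class
    number, so that k = h C / c is admissible.  An infinite Omega(B) would make
    the quotient 0, hence a lower bound for Omega(B) is enough.

    Upper bound ([counting_search_space_ideal_le]).  A nonzero algebraic integer
    has a conjugate of absolute value at least 1 ([integral_conj_lt1_eq0]), so the
    integers with all conjugates at most T are separated and there are at most
    C T^n of them ([integers_in_box]).  Translating m elements of C(a, B) by
    representatives of O_K / a gives m N(a) distinct integers in a box that is only
    a constant factor larger when B is large in terms of a; hence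
    m N(a) <= C B N(a), and the factor N(a) cancels.

    Lower bound ([counting_Omega_ge]).  A point with coordinates in O_K and all
    conjugates at most T has height at most T^n ([height_le]): a finite place
    contributes at most 1 and an archimedean place v at most T^(n_v).  Each such v
    is |sigma_j| for some j ([arch_place_conj]) and n_v is at most the number of
    these j, so the n_v add up to at most n.  Let Z[theta] be an order of K.  There
    are about T^(n(N+1)) tuples over Z[theta] in the box, but proportional tuples
    give the same point.  This does not happen among tuples whose first two
    coordinates x, y generate the unit ideal of Z[theta] and whose coordinates are
    all relatively close to one large rational integer: the ratio of two
    proportional tuples of this kind lies in Z[theta], because 1 = u x + v y, and
    all conjugates of this ratio are within 1 of 1, so that it is 1.

    It remains that a positive proportion of the pairs (x, y) generate the unit
    ideal ([coprime_pairs]).  All coordinates are taken congruent to 1 modulo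
    (16 n)!, so a prime ideal containing x and y lies above a prime p > 16 n.
    At most n prime ideals lie above p.  If p <= T, each of them excludes a
    proportion at most (2 / p)^2 of the pairs, and these add up to at most 1/4.  If
    p > T, then p divides a nonzero integer of size O(T^(2n)) in the ideal of x;
    each x has at most 2n such p, and each of them excludes a proportion O(1/T) of
    the y. *)

(** * An integral generator and the complex embeddings *)

(** The leading term of the derivative of the minimal polynomial survives in
    characteristic 0. *)
Lemma separable_rat (K : fieldExtType rat) (x : K) : separable_element 1 x.
Proof.
rewrite separable_nz_der; set p := minPoly _ _.
have sp : (1 < size p)%N by rewrite size_minPoly ltnS.
apply/eqP => /polyP /(_ (size p).-2).
rewrite coef_deriv coef0 -(subnKC sp) /= add0n.
have : p`_(size p).-1 = 1 by apply/monicP; exact: monic_minPoly.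
rewrite -{1}(subnKC sp) /= => ->.
have -> : (1 : K) *+ (size p - 2).+1 = (((size p - 2).+1%:R : rat)%:A).
  by rewrite scaler_nat.
by move/eqP; rewrite scaler_eq0 oner_eq0 orbF pnatr_eq0.
Qed.

Lemma horner_alg_wide (K : fieldExtType rat) (x : K) n (g : {poly rat}) :
  (size g <= n)%N -> horner_alg x g = \sum_(i < n) g`_i *: x ^+ i.
Proof.
move=> sg; rewrite {1}/horner_alg /horner_morph.
rewrite (@horner_coef_wide _ n) ?size_map_poly //; apply: eq_bigr => i _.
by rewrite coef_map /= mulr_algl.
Qed.

Lemma size_map_int (p : {poly int}) : size (map_poly (intr : int -> rat) p) = size p.
Proof. by rewrite size_map_inj_poly //; apply: intr_inj. Qed.

Definition integral_power_basis (K : fieldExtType rat) (theta : K) (f : {poly int}) : Prop :=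
  [/\ f \is monic, size f = (\dim {:K}).+1,
      horner_alg theta (map_poly intr f) = 0,
      forall g : {poly rat}, (size g <= \dim {:K})%N -> horner_alg theta g = 0 -> g = 0
    & forall x, exists2 g : {poly rat}, (size g <= \dim {:K})%N & x = horner_alg theta g].

(** The primitive element theorem gives a generator t, which need not be integral;
    if a is a common denominator for its minimal polynomial, then a t is integral. *)
Lemma integral_generator (K : fieldExtType rat) :
  exists (theta : K) (f : {poly int}), integral_power_basis theta f.
Proof.
set n : nat := \dim {:K}.
have sepK : separable 1 {:K}.
  by apply/separableP => x _; apply: separable_rat.
have := eq_adjoin_separable_generator sepK (sub1v _).
set t := separable_generator _ _ => Kt.
have [m mP] : exists m : {poly rat}, minPoly 1 t = map_poly (in_alg K) m.
  by apply/polyOver1P; apply: minPolyOver.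
have szm : size m = n.+1.
  have : size (minPoly 1 t) = n.+1.
    by rewrite size_minPoly /n [in RHS]Kt dim_Fadjoin dimv1 muln1.
  by rewrite mP size_map_poly.
have mon_m : m \is monic.
  by have := monic_minPoly 1 t; rewrite mP map_monic.
have [q [a a0 mq]] := rat_poly_scale m.
have aq : q`_n = a.
  have := monicP mon_m; rewrite /lead_coef szm /= mq coefZ coef_map /=.
  move/(congr1 ( *%R (a%:~R : rat))); rewrite mulrA mulfV ?intr_eq0 // mul1r mulr1.
  by move/intr_inj.
have n0 : (0 < n)%N by rewrite adim_gt0.
have aR0 : (a%:~R : K) != 0.
  have -> : (a%:~R : K) = (a%:~R : rat)%:A by rewrite scaler_int.
  by rewrite scaler_eq0 oner_eq0 orbF intr_eq0.
pose theta := a%:~R * t.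
(* a^(n-1) times the equation of t is a monic integral equation for a t. *)
pose low : {poly int} := \poly_(i < n) ((a ^+ (n.-1 - i) : int) * q`_i)%R.
pose f : {poly int} := 'X^n + low.
have szlow : (size low < size ('X^n : {poly int}))%N.
  by rewrite size_polyXn ltnS size_poly.
have szf : size f = n.+1 by rewrite /f size_polyDl // size_polyXn.
have szq : size q = n.+1.
  by rewrite -szm mq size_scale ?invr_eq0 ?intr_eq0 // size_map_int.
have tq : \sum_(i < n.+1) (q`_i)%:~R * t ^+ i = 0.
  have : (map_poly (in_alg K) m).[t] = 0 by rewrite -mP minPolyxx.
  rewrite -[LHS]/(horner_alg t m) mq linearZ /= => /(congr1 (fun y => a%:~R *: y)).
  rewrite scaler0 mulr_algl scalerA mulfV ?intr_eq0 // scale1r => tq; rewrite -[RHS]tq.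
  rewrite (@horner_alg_wide _ _ n.+1) ?size_map_int ?szq //.
  by apply: eq_bigr => i _; rewrite coef_map /= -mulr_algl scaler_int.
have ftheta : horner_alg theta (map_poly intr f) = 0.
  have lowi i : (i < n)%N -> f`_i = a ^+ (n.-1 - i) * q`_i.
    by move=> ltin; rewrite /f coefD coefXn (ltn_eqF ltin) add0r coef_poly ltin.
  have fn : f`_n = 1 by rewrite /f coefD coefXn eqxx coef_poly ltnn addr0.
  rewrite (@horner_alg_wide _ _ n.+1) ?size_map_int ?szf //.
  transitivity (a%:~R ^+ n.-1 * \sum_(i < n.+1) (q`_i)%:~R * t ^+ i); last first.
    by rewrite tq mulr0.
  rewrite big_distrr /=; apply: eq_bigr => i _.
  rewrite coef_map /= -mulr_algl scaler_int /theta exprMn.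
  have := ltn_ord i; rewrite ltnS leq_eqVlt => /orP[/eqP->|ltin].
    by rewrite fn aq mul1r !mulrA -exprSr prednK.
  rewrite lowi // rmorphM rmorphXn /= [_ * (q`_i)%:~R]mulrC -mulrA !mulrA.
  rewrite -[_ * _ * a%:~R ^+ i]mulrA -exprD subnK; last by rewrite -ltnS prednK.
  by rewrite [a%:~R ^+ n.-1 * _]mulrC.
have Kth : fullv = <<1; theta>>%VS :> {vspace K}.
  apply/eqP; rewrite eq_sym eqEsubv subvf /= Kt.
  apply/FadjoinP; split; first exact: subv_adjoin.
  have -> : t = (a%:~R)^-1 * theta by rewrite /theta mulrA mulVf // mul1r.
  apply: rpredM; last exact: memv_adjoin.
  by apply: rpredVr; apply: rpred_int.
have szth : size (minPoly 1 theta) = n.+1.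
  by rewrite size_minPoly /n [in RHS]Kth dim_Fadjoin dimv1 muln1.
have g0 (g : {poly rat}) : (size g <= n)%N -> horner_alg theta g = 0 -> g = 0.
  move=> sg hg; apply/eqP; apply: contraTT sg => g0; rewrite -ltnNge -szth.
  rewrite -(size_map_poly (in_alg K) g); apply: dvdp_leq.
    by rewrite map_poly_eq0.
  by apply: minPoly_dvdp; [apply: alg_polyOver | apply/rootP].
exists theta, f; split => //.
- by rewrite monicE lead_coefDl // lead_coefXn.
- move=> x; have : x \in <<1; theta>>%VS by rewrite -Kth memvf.
  case/Fadjoin1_polyP => g ->.
  exists (g %% map_poly intr f).
    have fQ0 : map_poly (intr : int -> rat) f != 0.
      by rewrite -size_poly_eq0 size_map_int szf.
    by have := ltn_modp g (map_poly (intr : int -> rat) f); rewrite fQ0 size_map_int szf.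
  rewrite -[(map_poly _ _).[_]]/(horner_alg theta g).
  by rewrite [in LHS](divp_eq g (map_poly intr f)) rmorphD rmorphM /= ftheta mulr0 add0r.
Qed.

(** * The absolute value of R[i] *)

Notation cabs := Normc.normc.

Section CAbs.
Variable R : realType.
Implicit Types z w : R[i].

Lemma cabs_ge0 z : 0 <= cabs z.
Proof. by case: z => a b; apply: sqrtr_ge0. Qed.

Lemma cabs_eq0 z : (cabs z == 0) = (z == 0).
Proof.
apply/eqP/eqP => [/Normc.eq0_normc //|->]; exact: Normc.normc0.
Qed.

Lemma cabsD z w : cabs (z + w) <= cabs z + cabs w.
Proof. exact: le_normcD. Qed.

Lemma cabsN z : cabs (- z) = cabs z.
Proof. exact: normcN. Qed.

Lemma cabs_ratr (q : rat) : cabs (ratr q : R[i]) = `|ratr q|.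
Proof.
have -> : (ratr q : R[i]) = (ratr q : R)%:C%C by rewrite fmorph_rat.
by rewrite /= expr0n addr0 sqrtr_sqr.
Qed.

Lemma cabs_int (m : int) : cabs (m%:~R : R[i]) = `|m%:~R|.
Proof.
have -> : (m%:~R : R[i]) = (m%:~R : R)%:C%C by rewrite rmorph_int.
by rewrite /= expr0n addr0 sqrtr_sqr.
Qed.

Lemma cabsX z k : cabs (z ^+ k) = cabs z ^+ k.
Proof.
by elim: k => [|k IH]; rewrite ?expr0 ?Normc.normc1 // !exprS Normc.normcM IH.
Qed.

Lemma cabs_sum (I : Type) (r : seq I) (P : pred I) (F : I -> R[i]) :
  cabs (\sum_(i <- r | P i) F i) <= \sum_(i <- r | P i) cabs (F i).
Proof.
elim/big_ind2: _ => [|x1 x2 y1 y2 h1 h2|//]; first by rewrite Normc.normc0.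
by apply: le_trans (cabsD _ _) _; apply: lerD.
Qed.

Lemma cabs_conj z : cabs z^*%C = cabs z.
Proof. by case: z => a b /=; rewrite sqrrN. Qed.

Lemma cabs_ge_Re z : `|complex.Re z| <= cabs z.
Proof.
case: z => a b /=; rewrite -sqrtr_sqr ler_sqrt ?addr_ge0 ?sqr_ge0 //.
by rewrite lerDl sqr_ge0.
Qed.

Lemma cabs_ge_Im z : `|complex.Im z| <= cabs z.
Proof.
case: z => a b /=; rewrite -sqrtr_sqr ler_sqrt ?addr_ge0 ?sqr_ge0 //.
by rewrite lerDr sqr_ge0.
Qed.

Lemma cabs_le_ReIm z : cabs z <= `|complex.Re z| + `|complex.Im z|.
Proof.
case: z => a b /=.
rewrite -(@ler_sqr R) ?nnegrE ?sqrtr_ge0 ?addr_ge0 //.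
rewrite sqr_sqrtr ?addr_ge0 ?sqr_ge0 // sqrrD !real_normK ?num_real //.
by rewrite lerD2r lerDl mulrn_wge0 // mulr_ge0.
Qed.
End CAbs.

(** * Embeddings from the roots of the generator polynomial *)

Section Embeddings.
Variables (K : fieldExtType rat) (theta : K) (f : {poly int}).
Hypothesis gen : integral_power_basis theta f.
Local Notation n := (\dim {:K}).
Local Notation fQ := (map_poly (intr : int -> rat) f).

(** The generator polynomial f is irreducible over Q: a common factor of f and a
    splits f into two polynomials of degree less than n, one of which would vanish
    at theta. *)
Lemma coprime_generator_poly (a : {poly rat}) : (size a <= n)%N -> a != 0 -> coprimep fQ a.
Proof.
case: gen => mon_f szf f0 free _ sa a0.
have fQ0 : fQ != 0 by rewrite -size_poly_eq0 size_map_int szf.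
have := dvdp_gcdl fQ a; have := dvdp_gcdr fQ a.
rewrite coprimep_def; set g := gcdp _ _ => ga /dvdpP [h fh].
have sgn : (size g <= n)%N by apply: leq_trans sa; apply: dvdp_leq.
have g0 : g != 0 by apply: contra_neq fQ0 => g0; rewrite fh g0 mulr0.
have h0 : h != 0 by apply: contra_neq fQ0 => h0; rewrite fh h0 mul0r.
have := congr1 (fun p : {poly rat} => size p) fh.
rewrite size_map_int szf size_mul //.
move: (f0); rewrite fh rmorphM /= => /eqP; rewrite mulf_eq0 => /orP[] /eqP.
  move=> hth; have [shn|] := leqP (size h) n.
    by move/(free h shn): hth h0 => ->; rewrite eqxx.
  rewrite -size_poly_gt0 in g0; move: g0; move: (size g) (size h) (\dim _) => u v w; simpl in w; lia.
by move/(free g sgn) => g0'; rewrite g0' eqxx in g0.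
Qed.

Lemma morph_horner_alg (L : fieldType) (s : {rmorphism K -> L}) (x : K) (g : {poly rat}) :
  s (horner_alg x g) = (map_poly ratr g).[s x].
Proof.
rewrite -horner_map /= -map_poly_comp; congr (_.[_]).
by apply: eq_map_poly => q /=; apply: (fmorph_eq_rat (s \o in_alg K)).
Qed.

(** A root tau of f determines an embedding by g(theta) |-> g(tau), which is well
    defined since g(theta) = 0 forces f to divide g. *)
Lemma embedding_of_root (L : numFieldType) (tau : L) : root (map_poly intr f) tau ->
  exists s : {rmorphism K -> L}, s theta = tau.
Proof.
case: gen => mon_f szf f0 free span ftau.
have fQtau : (map_poly ratr fQ).[tau] = 0.
  rewrite -map_poly_comp -[RHS](rootP ftau); congr (_.[_]).
  by apply: eq_map_poly => m /=; rewrite ratr_int.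
have kill (g : {poly rat}) : horner_alg theta g = 0 -> (map_poly ratr g).[tau] = 0.
  move=> g0; rewrite (divp_eq g fQ) rmorphD rmorphM /= hornerD hornerM fQtau mulr0 add0r.
  have fQ0 : fQ != 0 by rewrite -size_poly_eq0 size_map_int szf.
  have := ltn_modp g fQ; rewrite fQ0 size_map_int szf ltnS => sm.
  rewrite (free _ sm) ?rmorph0 ?horner0 //.
  by move: g0; rewrite {1}(divp_eq g fQ) rmorphD rmorphM /= f0 mulr0 add0r.
pose c x := sval (cid2 (span x)).
have cP x : horner_alg theta (c x) = x by rewrite /c; case: cid2.
pose s0 x : L := (map_poly ratr (c x)).[tau].
have s0E g : s0 (horner_alg theta g) = (map_poly ratr g).[tau].
  apply/eqP; rewrite -subr_eq0 -hornerN -hornerD -rmorphB /=; apply/eqP/kill.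
  by rewrite rmorphB /= cP subrr.
have addM : zmod_morphism s0.
  by move=> x y; rewrite -[x]cP -[y]cP -rmorphB !s0E rmorphB hornerD hornerN.
have mulM : monoid_morphism s0.
  split; first by rewrite -[1](rmorph1 (horner_alg theta)) s0E rmorph1 hornerC.
  by move=> x y; rewrite -[x]cP -[y]cP -rmorphM !s0E rmorphM hornerM.
pose sA := GRing.isZmodMorphism.Build _ _ s0 addM.
pose sM := GRing.isMonoidMorphism.Build _ _ s0 mulM.
pose s : {rmorphism K -> L} := HB.pack s0 sA sM.
exists s; rewrite /= -[theta in LHS](horner_algX theta) s0E.
by rewrite map_polyX hornerX.
Qed.

(** The roots of f are distinct because f is prime to its derivative, and they are
    permuted by complex conjugation because f has integer coefficients. *)
Lemma embeddings (R : realType) : exists s : 'I_n -> {rmorphism K -> R[i]},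
  injective (fun j => s j theta) /\
  forall j, exists j', forall x, s j' x = (s j x)^*%C.
Proof.
have [mon_f szf f0 free span] := gen.
pose fC : {poly R[i]} := map_poly intr f.
have fCE : fC = map_poly ratr fQ.
  by rewrite -map_poly_comp; apply: eq_map_poly => m /=; rewrite ratr_int.
have [r fr] := closed_field_poly_normal fC.
have monC : fC \is monic.
  by rewrite fCE monicE lead_coef_map (eqP (monic_map intr mon_f)) rmorph1.
rewrite (monicP monC) scale1r in fr.
have szr : size r = n.
  apply/eqP; rewrite -eqSS -(size_prod_XsubC r id) -fr fCE size_map_poly.
  by rewrite size_map_int szf.
have rootr t : (t \in r) = root fC t by rewrite fr root_prod_XsubC.
have uniq_r : uniq r.
  rewrite -separable_prod_XsubC -fr fCE separable_poly.unlock deriv_map coprimep_map.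
  have n0 : (0 < n)%N by rewrite adim_gt0.
  have fQn : fQ^`()`_n.-1 = n%:R.
    rewrite coef_deriv prednK //.
    by have := monicP mon_f; rewrite /lead_coef szf coef_map /= => ->.
  apply: coprime_generator_poly.
    by have := lt_size_deriv (p := fQ); rewrite -size_poly_eq0 size_map_int szf => /(_ isT).
  apply: contraTneq n0 => d0; move/eqP: fQn; rewrite d0 coef0 eq_sym pnatr_eq0 => /eqP->.
  by [].
have sP (j : 'I_n) : exists s : {rmorphism K -> R[i]}, s theta = r`_j.
  by apply: embedding_of_root; rewrite -rootr mem_nth // szr.
exists (fun j => sval (cid (sP j))); split.
  move=> i j /=; case: cid => /= s ->; case: cid => /= s' -> /eqP.
  by rewrite nth_uniq ?szr // => /eqP/val_inj.
move=> j; set s := sval _.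
have : s theta \in r by rewrite /s; case: cid => /= s' ->; rewrite mem_nth // szr.
rewrite rootr => /(rmorph_root (@conjc R)).
have -> : map_poly (@conjc R) fC = fC.
  by rewrite /fC -map_poly_comp; apply: eq_map_poly => m /=; rewrite rmorph_int.
rewrite -rootr => /(nthP 0) [k]; rewrite szr => kn rk.
exists (Ordinal kn) => x; case: cid => /= s' s'th.
have [g _ ->] := span x.
rewrite morph_horner_alg s'th rk -[RHS]/((@conjc R \o s) (horner_alg theta g)).
by rewrite (morph_horner_alg (@conjc R \o s)).
Qed.

End Embeddings.

(** * Absolute values and approximation *)

Lemma exists_expr_lt (R : realType) (r e : R) : 0 <= r -> r < 1 -> 0 < e ->
  exists M, forall k, (M <= k)%N -> r ^+ k < e.
Proof.
move=> r0 r1 e0; have := @cvg_expr R r.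
rewrite ger0_norm // => /(_ r1)/cvgrPdist_lt/(_ _ e0)[M _ HM].
exists M => k Mk; have := HM k Mk; rewrite /= sub0r normrN ger0_norm //.
exact: exprn_ge0.
Qed.

(** The constant C is absorbed by taking k-th roots.  This removes the constants
    from estimates of multiplicative functions. *)
Lemma le_of_expr_le (R : realType) (a M C : R) : 0 <= a -> 0 <= M ->
  (forall k, a ^+ k <= C * M ^+ k) -> a <= M.
Proof.
move=> a0 M0 H; rewrite leNgt; apply/negP => Ma.
have a1 : 0 < a by apply: le_lt_trans Ma.
have C0 : 0 < C by have := H 0; rewrite !expr0 mulr1; apply: lt_le_trans.
have [k Hk] := @exists_expr_lt R (M / a) C^-1 (divr_ge0 M0 a0)
  ltac:(by rewrite ltr_pdivrMr // mul1r) ltac:(by rewrite invr_gt0).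
have := Hk k (leqnn k); rewrite expr_div_n ltr_pdivrMr ?exprn_gt0 //.
rewrite mulrC ltr_pdivlMr // => /lt_le_trans/(_ (H k)).
by rewrite mulrC ltxx.
Qed.

Lemma uniform_eventually m (P : 'I_m -> nat -> Prop) :
  (forall i, exists M, forall k, (M <= k)%N -> P i k) ->
  exists M, forall i k, (M <= k)%N -> P i k.
Proof.
move=> H; exists (\max_i sval (cid (H i))) => i k Mk.
apply: (svalP (cid (H i))); apply: leq_trans Mk; exact: leq_bigmax.
Qed.

Section Absval.
Variables (R : realType) (K : fieldType) (v : K -> R).
Hypothesis vP : is_absval v.

Lemma absval_ge0 x : 0 <= v x. Proof. by case: vP. Qed.
Lemma absvalM x y : v (x * y) = v x * v y. Proof. by case: vP. Qed.
Lemma absvalD x y : v (x + y) <= v x + v y. Proof. by case: vP. Qed.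
Lemma absval0 : v 0 = 0. Proof. by case: vP => _ H _ _; apply/H. Qed.
Lemma absval_gt0 x : x != 0 -> 0 < v x.
Proof.
by case: vP => H0 H _ _ x0; rewrite lt_neqAle eq_sym H0 andbT; apply: contraNneq x0 => /H->.
Qed.
Lemma absval1 : v 1 = 1.
Proof.
have v1 : v 1 != 0 by rewrite gt_eqF // absval_gt0 // oner_neq0.
by apply: (mulfI v1); rewrite -absvalM !mulr1.
Qed.
Lemma absvalN x : v (- x) = v x.
Proof.
suff H : v (-1) = 1 by rewrite -mulN1r absvalM H mul1r.
have := absvalM (-1) (-1); rewrite mulrNN mulr1 absval1 -expr2 => /esym/eqP.
by rewrite sqrf_eq1 => /orP[/eqP//|/eqP h]; have := absval_ge0 (-1); rewrite h; lra.
Qed.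
Lemma absvalX x k : v (x ^+ k) = v x ^+ k.
Proof. by elim: k => [|k IH]; rewrite ?expr0 ?absval1 // !exprS absvalM IH. Qed.
Lemma absvalV x : v x^-1 = (v x)^-1.
Proof.
have [->|x0] := eqVneq x 0; first by rewrite invr0 absval0 invr0.
have vx : v x != 0 by rewrite gt_eqF // absval_gt0.
by apply: (mulfI vx); rewrite -absvalM !mulfV // absval1.
Qed.
Lemma absval_sum (I : Type) (r : seq I) (P : pred I) (F : I -> K) :
  v (\sum_(i <- r | P i) F i) <= \sum_(i <- r | P i) v (F i).
Proof.
elim/big_ind2: _ => [|x1 x2 y1 y2 h1 h2|//]; first by rewrite absval0.
by apply: le_trans (absvalD _ _) _; apply: lerD.
Qed.
Lemma absval_ge_sub x y : v x - v y <= v (x + y).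
Proof. by rewrite lerBlDr -(absvalN y) -{1}(addrK y x); apply: absvalD. Qed.
End Absval.

(** Approximation for absolute values: if v can be separated from each w_j, then one
    element separates v from all of them.  Induction on the number of w_j: given z for
    the first ones and y for the next one w, the element z^q y works when w(z) <= 1,
    and y z^q / (1 + z^q) when w(z) > 1, for q large; the last factor tends to 1 at
    the places where z is large and to 0 where z is small. *)
Lemma artin_whaples (R : realType) (K : fieldType) (v : K -> R) m (w : 'I_m -> K -> R) :
  is_absval v -> (forall j, is_absval (w j)) -> (exists z, 1 < v z) ->
  (forall j, exists y, 1 < v y /\ w j y < 1) ->
  exists z, 1 < v z /\ forall j, w j z < 1.
Proof.
move=> vP wP [z0 vz0] sep.
suff H k : (k <= m)%N -> exists z, 1 < v z /\ forall j : 'I_m, (j < k)%N -> w j z < 1.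
  by have [z [? Hz]] := H m (leqnn m); exists z; split => // j; apply: Hz.
elim: k => [_|k IH km]; first by exists z0.
have [z [vz wz]] := IH (ltnW km).
have [y [vy wy]] := sep (Ordinal km); set l := Ordinal km in wy.
have jP (j : 'I_m) : (j < k.+1)%N -> j = l \/ (j < k)%N.
  by rewrite ltnS leq_eqVlt => /orP[/eqP jk|]; [left; apply: val_inj|right].
(* When w_l(z) <= 1, high powers of z do not spoil the smallness of y at w_l. *)
have [wlz|wlz] := leP (w l z) 1.
  have : forall j : 'I_m, exists M, forall q, (M <= q)%N -> (j < k)%N -> w j (z ^+ q * y) < 1.
    move=> j; have [jk|] := ltnP j k; last by exists 0.
    have [M HM] := @exists_expr_lt R (w j z) (1 + w j y)^-1 (absval_ge0 (wP j) _) (wz j jk)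
      ltac:(by rewrite invr_gt0 ltr_pwDl // absval_ge0).
    exists M => q Mq _; rewrite absvalM // absvalX //.
    have := HM q Mq; rewrite -[_^-1]mul1r ltr_pdivlMr ?ltr_pwDl ?absval_ge0 //.
    have := exprn_ge0 q (absval_ge0 (wP j) z); have := absval_ge0 (wP j) y.
    move: (w j z ^+ q) (w j y) => a b; nra.
  move/uniform_eventually => [q Hq]; exists (z ^+ q * y); split.
    rewrite absvalM // absvalX //; apply: lt_le_trans vy _.
    by rewrite ler_peMl ?absval_ge0 // exprn_ege1 // ltW.
  move=> j /jP[->|jk]; last by apply: (Hq j q).
  rewrite absvalM // absvalX //; apply: le_lt_trans wy.
  by rewrite ler_piMl ?absval_ge0 // exprn_ile1 // absval_ge0.
(* When w_l(z) > 1, the element z^q / (1 + z^q) y is used. *)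
have E1 (u : K -> R) (r : R) : is_absval u -> 1 < u z -> 0 < r ->
    exists M, forall q, (M <= q)%N -> 1 < r * u z ^+ q.
  move=> uP uz r0; have uz0 : 0 < u z by apply: lt_trans uz.
  have [M HM] := @exists_expr_lt R (u z)^-1 r ltac:(by rewrite invr_ge0 ltW)
    ltac:(by rewrite invf_lt1) r0.
  by exists M => q /HM; rewrite exprVn -[_^-1]mul1r ltr_pdivrMr // exprn_gt0.
have [M1 H1] := E1 v (v y - 1) vP vz ltac:(by rewrite subr_gt0).
have [M3 H3] := E1 v 1 vP vz ltr01.
have [M2 H2] := E1 (w l) (1 - w l y) (wP l) wlz ltac:(by rewrite subr_gt0).
have : forall j : 'I_m, exists M, forall q, (M <= q)%N -> (j < k)%N ->
    w j z ^+ q * (2 + w j y) < 1.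
  move=> j; have [jk|] := ltnP j k; last by exists 0.
  have p2 : 0 < 2 + w j y by rewrite ltr_pwDl // absval_ge0.
  have [M HM] := @exists_expr_lt R (w j z) (2 + w j y)^-1 (absval_ge0 (wP j) _) (wz j jk)
      ltac:(by rewrite invr_gt0).
  by exists M => q Mq _; rewrite -ltr_pdivlMr // mul1r HM.
move/uniform_eventually => [M4 H4].
pose q := maxn (maxn M1 M2) (maxn M3 M4).
have {}H1 : 1 < (v y - 1) * v z ^+ q by apply: H1; rewrite !leq_max leqnn.
have {}H2 : 1 < (1 - w l y) * w l z ^+ q by apply: H2; rewrite !leq_max leqnn orbT.
have {}H3 : 1 < 1 * v z ^+ q by apply: H3; rewrite !leq_max leqnn !orbT.
have {}H4 j := H4 j q ltac:(by rewrite !leq_max leqnn !orbT).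
have z1 : 1 + z ^+ q != 0.
  apply/negP => /eqP h; have := absval_ge_sub vP (z ^+ q) 1.
  by rewrite [z ^+ q + 1]addrC h absval0 // absval1 // absvalX // subr_le0;
    rewrite mul1r in H3; rewrite leNgt H3.
have uE (u : K -> R) : is_absval u ->
    u (z ^+ q / (1 + z ^+ q) * y) = u z ^+ q * u y / u (1 + z ^+ q).
  by move=> uP; rewrite !absvalM // absvalV // absvalX // mulrAC.
exists (z ^+ q / (1 + z ^+ q) * y); split.
  rewrite uE // ltr_pdivlMr ?absval_gt0 // mul1r.
  apply: le_lt_trans (absvalD vP _ _) _; rewrite absval1 // absvalX //.
  by move: H1; move: (v z ^+ q) => a; nra.
move=> j /jP[->|jk]; rewrite uE // ltr_pdivrMr ?absval_gt0 // mul1r.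
  rewrite [1 + _]addrC; apply: lt_le_trans (absval_ge_sub (wP l) _ _).
  rewrite absvalX // absval1 //; move: H2; move: (w l z ^+ q) => a; nra.
apply: lt_le_trans (absval_ge_sub (wP j) _ _).
rewrite absvalX // absval1 //; move: (H4 j jk).
have := exprn_ge0 q (absval_ge0 (wP j) z); have := absval_ge0 (wP j) y.
move: (w j z ^+ q) => a; nra.
Qed.

(** * Conjugates, archimedean places and algebraic integers *)

(** Euclidean division of X^k by a monic integer polynomial that vanishes at x. *)
Lemma integral_power_reduction (K : fieldExtType rat) (x : K) : ring_of_integers K x ->
  exists m, forall k, exists r : nat -> int, x ^+ k = \sum_(i < m) (r i)%:~R * x ^+ i.
Proof.
case=> p mon_p rpx; exists (size p) => k.
have p0 := monic_neq0 mon_p.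
pose r := Pdiv.Ring.rmodp 'X^k p.
have sr : (size r < size p)%N by rewrite Pdiv.Ring.ltn_rmodp.
exists (fun i => r`_i).
have := Pdiv.RingMonic.rdivp_eq mon_p 'X^k; rewrite -/r.
move/(congr1 (fun u => (map_poly (intr : int -> K) u).[x])) => /=.
rewrite map_polyXn hornerXn => ->; rewrite rmorphD rmorphM /= hornerD hornerM.
rewrite (rootP rpx) mulr0 add0r (@horner_coef_wide _ (size p)).
  by apply: eq_bigr => i _; rewrite coef_map.
by apply: leq_trans (size_poly _ _) (ltnW sr).
Qed.

Section Conjugates.
Variables (R : realType) (K : fieldExtType rat) (theta : K) (f : {poly int}).
Hypothesis gen : integral_power_basis theta f.
Local Notation n := (\dim {:K}).
Variable s : 'I_n -> {rmorphism K -> R[i]}.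
Hypothesis s_inj : injective (fun j => s j theta).

Lemma dim_gt0 : (0 < n)%N. Proof. exact: adim_gt0. Qed.

Lemma conj_horner_alg j (g : {poly rat}) : (size g <= n)%N ->
  s j (horner_alg theta g) = \sum_(i < n) ratr g`_i * s j theta ^+ i.
Proof.
move=> sg; rewrite morph_horner_alg (@horner_coef_wide _ n) ?size_map_poly //.
by apply: eq_bigr => i _; rewrite coef_map.
Qed.

(** The conjugates of g(theta) are obtained from the coefficients of g by a
    Vandermonde matrix, which is invertible since the sigma_j(theta) are distinct. *)
Lemma coef_le_conj : exists2 C : R, 0 < C &
  forall (g : {poly rat}) (M : R), (size g <= n)%N ->
    (forall j, cabs (s j (horner_alg theta g)) <= M) -> forall i, `|ratr g`_i| <= C * M.
Proof.
pose V : 'M[R[i]]_n := Vandermonde n (\row_j s j theta).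
have Vu : V \in unitmx.
  rewrite unitmxE unitfE det_Vandermonde; apply/prodf_neq0 => i _.
  apply/prodf_neq0 => j ij; rewrite !mxE subr_eq0.
  by apply: contraTneq ij => /s_inj ->; rewrite ltnn.
pose W := invmx V; pose C := 1 + \sum_(i < n) \sum_(j < n) cabs (W j i).
have C0 : 0 < C.
  rewrite /C ltr_pwDl // sumr_ge0 // => i _; apply: sumr_ge0 => j _; exact: cabs_ge0.
exists C => // g M sg gM i.
have M0 : 0 <= M by apply: le_trans (gM (Ordinal dim_gt0)); apply: cabs_ge0.
have [ni|iln] := leqP n i.
  by rewrite nth_default ?(leq_trans sg) // rmorph0 normr0 mulr_ge0 // ltW.
pose q : 'rV[R[i]]_n := \row_i ratr g`_i.
pose y : 'rV[R[i]]_n := \row_j s j (horner_alg theta g).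
have qV : q *m V = y.
  apply/rowP => j; rewrite !mxE conj_horner_alg //; apply: eq_bigr => k _.
  by rewrite !mxE.
have qE : q = y *m W by rewrite -qV mulmxK.
rewrite -cabs_ratr.
have -> : ratr g`_i = q 0 (Ordinal iln) by rewrite mxE.
rewrite qE mxE; apply: le_trans (cabs_sum _ _ _) _.
apply: (@le_trans _ _ (\sum_(j < n) M * cabs (W j (Ordinal iln)))).
  apply: ler_sum => j _; rewrite Normc.normcM mxE ler_wpM2r ?cabs_ge0 //; exact: gM.
rewrite -big_distrr /= mulrC ler_wpM2r // /C [X in _ <= 1 + X](bigD1 (Ordinal iln)) //=.
rewrite addrCA lerDl addr_ge0 // sumr_ge0 // => k _; apply: sumr_ge0 => j _; exact: cabs_ge0.
Qed.

(** The triangle inequality and [coef_le_conj] bound v(x^k) by a constant times the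
    k-th power of the largest conjugate; [le_of_expr_le] removes the constant. *)
Lemma arch_le_conj (v : K -> R) (x : K) (M : R) : arch_place v ->
  (forall j, cabs (s j x) <= M) -> v x <= M.
Proof.
case=> vP vQ xM.
have M0 : 0 <= M by apply: le_trans (xM (Ordinal dim_gt0)); apply: cabs_ge0.
have [C C0 HC] := coef_le_conj.
apply: (@le_of_expr_le _ _ _ (C * \sum_(i < n) v theta ^+ i)) => [|//|k].
  exact: absval_ge0.
rewrite -absvalX //.
have [g sg xg] : exists2 g : {poly rat}, (size g <= n)%N & x ^+ k = horner_alg theta g.
  by case: gen.
rewrite xg (horner_alg_wide _ sg); apply: le_trans (absval_sum vP _ _ _) _.
apply: (@le_trans _ _ (\sum_(i < n) C * M ^+ k * v theta ^+ i)); last first.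
  by rewrite -big_distrr /= mulrAC.
apply: ler_sum => i _; rewrite -mulr_algl absvalM // vQ absvalX //.
rewrite ler_wpM2r ?exprn_ge0 ?absval_ge0 //; apply: HC => // j.
by rewrite -xg rmorphXn /= cabsX lerXn2r ?nnegrE ?cabs_ge0.
Qed.

Lemma conj_absval j : arch_place (fun x => cabs (s j x)).
Proof.
split; first split.
- by move=> x; apply: cabs_ge0.
- move=> x; split => [/eqP|->]; last by rewrite rmorph0; apply: Normc.normc0.
  by rewrite cabs_eq0 fmorph_eq0 => /eqP.
- by move=> x y; rewrite rmorphM Normc.normcM.
- by move=> x y; rewrite rmorphD cabsD.
- move=> q; have -> : s j q%:A = ratr q by apply: (fmorph_eq_rat (s j \o in_alg K)).
  exact: cabs_ratr.
Qed.

(** Otherwise v differs from each |sigma_j|, which yields for each j an element where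
    v exceeds 1 > |sigma_j| (after inverting it and scaling it by a rational number).
    By [artin_whaples] some z has v(z) > 1 and all conjugates less than 1, against
    [arch_le_conj]. *)
Lemma arch_place_conj (v : K -> R) : arch_place v -> exists j, forall x, v x = cabs (s j x).
Proof.
move=> vA; have [vP vQ] := vA; apply: contrapT => noj.
pose w j x := cabs (s j x).
have wP j : is_absval (w j) by case: (conj_absval j).
have [z [vz wz]] : exists z, 1 < v z /\ forall j, w j z < 1.
  apply: artin_whaples => //.
    by exists ((2%:Q)%:A); rewrite vQ ratr_int ger0_norm // ltr1n.
  move=> j.
  have [x wv] : exists x, w j x < v x.
    apply: contrapT => nox; apply: noj; exists j => x; apply/eqP.
    have le y : v y <= w j y by rewrite leNgt; apply/negP => h; apply: nox; exists y.
    rewrite eq_le le /=; have [->|x0] := eqVneq x 0; first by rewrite rmorph0 Normc.normc0 absval_ge0.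
    have := le x^-1; rewrite !absvalV // lef_pV2 //.
    - by rewrite posrE absval_gt0.
    - by rewrite posrE absval_gt0.
  have [r] := rat_in_itvoo wv; rewrite in_itv /= => /andP[wr rv].
  have r0 : 0 < (ratr r : R) by apply: le_lt_trans wr; apply: cabs_ge0.
  exists (x * (r^-1)%:A); rewrite !absvalM // vQ.
  have -> : w j (r^-1)%:A = `|ratr r^-1| by exact: (conj_absval j).2.
  rewrite fmorphV ger0_norm ?invr_ge0 ?ltW //; split.
    by rewrite ltr_pdivlMr // mul1r.
  by rewrite ltr_pdivrMr // mul1r.
have := @arch_le_conj v z (\big[Num.max/0]_j w j z) vA (fun j => le_bigmax _ _ j).
rewrite leNgt => /negP; apply; apply: lt_trans vz.
by apply/bigmax_ltP; split.
Qed.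

Lemma horner_alg_intZ (x : K) (a : int) (q : {poly int}) :
  horner_alg x (map_poly intr (a *: q)) = a%:~R * horner_alg x (map_poly intr q).
Proof.
by rewrite -mul_polyC 2!rmorphM /= map_polyC /= horner_algC scaler_int.
Qed.

(** The powers of x span a finitely generated group, so one denominator serves for
    the coordinates of all of them. *)
Lemma integral_powers_bounded_denominator (x : K) : ring_of_integers K x ->
  exists2 D : int, D != 0 & forall k, exists2 h : {poly int}, (size h <= n)%N &
    D%:~R * x ^+ k = horner_alg theta (map_poly intr h).
Proof.
case/integral_power_reduction => m Hm; have [_ _ _ _ span] := gen.
have [D D0 HD] : exists2 D : int, D != 0 & forall k, (k < m)%N ->
    exists2 h : {poly int}, (size h <= n)%N &
    D%:~R * x ^+ k = horner_alg theta (map_poly intr h).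
  elim: {Hm} m => [|m [D D0 IH]]; first by exists 1.
  have [g sg xg] := span (x ^+ m).
  have [q [a a0 gq]] := rat_poly_scale g.
  have sq : (size q <= n)%N.
    by rewrite -(size_map_int q) -(size_scale _ (_ : a%:~R^-1 != 0 :> rat)) -?gq // invr_eq0 intr_eq0.
  exists (D * a); first by rewrite mulf_neq0.
  move=> k; rewrite ltnS leq_eqVlt => /orP[/eqP->|/IH [h sh xh]].
    exists (D *: q); first by rewrite (leq_trans (size_scale_leq _ _)).
    rewrite xg gq horner_alg_intZ rmorphM /= -mulrA; congr (_ * _).
    by rewrite linearZ /= mulr_algl mulrzl -scaler_int scalerA mulfV ?intr_eq0 // scale1r.
  exists (a *: h); first by rewrite (leq_trans (size_scale_leq _ _)).
  by rewrite horner_alg_intZ -xh rmorphM /= mulrA [a%:~R * _]mulrC.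
exists D => // k; have [r xk] := Hm k.
pose h i := if insub i is Some k then s2val (cid2 (HD (val (k : 'I_(m))) (valP k))) else 0.
have hP (i : 'I_(m)) : (size (h i) <= n)%N /\
    D%:~R * x ^+ i = horner_alg theta (map_poly intr (h i)).
  by rewrite /h valK; case: cid2.
exists (\sum_(i < m) r i *: h i).
  apply: leq_trans (size_sum _ _ _) _; apply/bigmax_leqP => i _.
  by apply: leq_trans (size_scale_leq _ _) _; case: (hP i).
rewrite xk big_distrr /= !rmorph_sum /=; apply: eq_bigr => i _.
by rewrite horner_alg_intZ -(hP i).2 mulrCA.
Qed.

(** If all conjugates of x are less than 1, the powers of x tend to 0; their
    coordinates are rational with a bounded denominator, so some power of x is 0. *)
Lemma integral_conj_lt1_eq0 (x : K) : ring_of_integers K x ->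
  (forall j, cabs (s j x) < 1) -> x = 0.
Proof.
move=> xO xs; have [D D0 HD] := integral_powers_bounded_denominator xO.
have [C C0 HC] := coef_le_conj.
pose M := \big[Num.max/0]_j cabs (s j x).
have M0 : 0 <= M by apply: bigmax_ge_id.
have M1 : M < 1 by apply/bigmax_ltP; split.
(* The coordinates of D x^k are integers bounded by A M^k. *)
pose A : R := C * `|D%:~R|.
have A0 : 0 < A by rewrite mulr_gt0 // normr_gt0 intr_eq0.
have [k Hk] := @exists_expr_lt R M A^-1 M0 M1 ltac:(by rewrite invr_gt0).
have [h sh xh] := HD k.
have h0 : h = 0.
  apply/polyP => i; rewrite coef0.
  have : `|(h`_i)%:~R| < 1 :> R.
    have -> : (h`_i)%:~R = ratr ((map_poly (intr : int -> rat) h)`_i) :> R.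
      by rewrite coef_map /= ratr_int.
    apply: (@le_lt_trans _ _ (C * (`|D%:~R| * M ^+ k))).
      apply: HC; first by rewrite size_map_int.
      move=> j; rewrite -xh rmorphM rmorphXn /= rmorph_int Normc.normcM cabs_int cabsX.
      rewrite ler_wpM2l // lerXn2r ?nnegrE ?cabs_ge0 //; exact: le_bigmax.
    rewrite mulrA -/A mulrC -ltr_pdivlMr // div1r; exact: Hk.
  by rewrite -intr_norm ltrz1 => h1; apply/eqP; rewrite -normr_le0 -ltzD1 add0r.
move: xh; rewrite h0 !rmorph0 => /eqP; rewrite mulf_eq0.
have -> : (D%:~R == 0 :> K) = false.
  by rewrite -(@scaler_int rat) scaler_eq0 oner_eq0 orbF intr_eq0; apply/negbTE.
by rewrite expf_eq0 => /= /andP[_ /eqP].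
Qed.

Lemma conj_lt1_of_close : exists2 A : R, 0 < A &
  forall (g h : {poly rat}) , (size g <= n)%N -> (size h <= n)%N ->
   (forall i, A * `|ratr g`_i - ratr h`_i| < 1) ->
   forall j, cabs (s j (horner_alg theta g - horner_alg theta h)) < 1.
Proof.
pose B : R := \sum_(j < n) \sum_(i < n) cabs (s j theta) ^+ i.
have B0 : 0 <= B.
  by apply: sumr_ge0 => j _; apply: sumr_ge0 => i _; rewrite exprn_ge0 // cabs_ge0.
exists (1 + B) => [|g h sg sh H j]; first by rewrite ltr_pwDl.
have B1 : 0 < 1 + B by rewrite ltr_pwDl.
rewrite -rmorphB /= conj_horner_alg; last first.
  by rewrite (leq_trans (size_polyD _ _)) // geq_max size_polyN sg.
apply: le_lt_trans (cabs_sum _ _ _) _.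
apply: (@le_lt_trans _ _ (\sum_(i < n) (1 + B)^-1 * cabs (s j theta) ^+ i)).
  apply: ler_sum => i _; rewrite Normc.normcM cabsX ler_wpM2r ?exprn_ge0 ?cabs_ge0 //.
  rewrite cabs_ratr coefB rmorphB /=.
  by have := H i; rewrite mulrC -ltr_pdivlMr // div1r => /ltW.
rewrite -big_distrr /= mulrC ltr_pdivrMr // mul1r.
apply: (@le_lt_trans _ _ B); last by rewrite ltrDr.
rewrite /B [X in _ <= X](bigD1 j) //= lerDl; apply: sumr_ge0 => k _; apply: sumr_ge0 => i _.
by rewrite exprn_ge0 // cabs_ge0.
Qed.

End Conjugates.

(** * Counting algebraic integers in a box *)

Section Counting.
Variables (R : realType) (K : fieldExtType rat) (theta : K) (f : {poly int}).
Hypothesis gen : integral_power_basis theta f.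
Local Notation n := (\dim {:K}).
Variable s : 'I_n -> {rmorphism K -> R[i]}.
Hypothesis s_inj : injective (fun j => s j theta).

Lemma ring_of_integersB (x y : K) :
  ring_of_integers K x -> ring_of_integers K y -> ring_of_integers K (x - y).
Proof. exact: (integral_sub (RtoK := intr)). Qed.

Lemma ring_of_integersD (x y : K) :
  ring_of_integers K x -> ring_of_integers K y -> ring_of_integers K (x + y).
Proof. exact: (integral_add (RtoK := intr)). Qed.

Lemma floor_eq_dist (a b : R) : Num.floor a = Num.floor b -> `|a - b| < 1.
Proof.
move=> ab; have /andP[a1 a2] := mem_rg1_floor a; have /andP[b1 b2] := mem_rg1_floor b.
by rewrite ltr_norml; rewrite -ab in b1 b2; apply/andP; split; lra.
Qed.

(** The coordinates of these integers are O(T).  Cutting the coordinate space into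
    cubes so small that two points of a cube have all conjugates less than 1 apart,
    each cube contains at most one integer by [integral_conj_lt1_eq0]. *)
Lemma integers_in_box : exists2 C : R, 0 < C &
  forall (T : R) (S : seq K), 1 <= T -> uniq S ->
    (forall x, x \in S -> ring_of_integers K x /\ forall j, cabs (s j x) <= T) ->
    (size S)%:R <= C * T ^+ n.
Proof.
have [A A0 HA] := conj_lt1_of_close theta s.
have [C C0 HC] := coef_le_conj s_inj.
have [_ _ _ _ span] := gen.
exists ((2 * A * C + 3) ^+ n) => [|T S T1 uS HS].
  by rewrite exprn_gt0 // ltr_wpDl // !mulr_ge0 // ltW.
have T0 : 0 < T by apply: lt_le_trans T1.
pose c x := sval (cid2 (span x)).
have cP x : (size (c x) <= n)%N /\ horner_alg theta (c x) = x by rewrite /c; case: cid2.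
pose k := (Num.truncn (A * C * T)).+1.
have kP : A * C * T < k%:R by apply: truncnS_gt.
have kle : k%:R <= A * C * T + 1.
  by rewrite /k -natr1 lerD2r truncn_le !mulr_ge0 ?ltW.
pose fl x i := Num.floor (A * ratr (c x)`_i).
(* The number of the cube containing x; adding k makes the cell numbers natural. *)
pose idx x := [ffun i : 'I_n => inord (absz (fl x i + k%:Z)%R) : 'I_(k.*2).+1].
have flP x i : x \in S -> - k%:Z <= fl x i /\ fl x i < k%:Z.
  move=> /HS[_ xs]; have := HC (c x) T (cP x).1.
  rewrite (cP x).2 => /(_ xs i); rewrite -(ler_pM2l A0) mulrA.
  rewrite -[A * `|_|]ger0_norm ?mulr_ge0 ?(ltW A0) // normrM normr_id -normrM.
  move=> /le_lt_trans/(_ kP); rewrite ltr_norml => /andP[h1 h2]; split.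
    by rewrite floor_ge_int ltW // rmorphN.
  by rewrite floor_lt_int.
have idx_inj : {in S &, injective idx}.
  move=> x y xS yS /ffunP E; apply/eqP; rewrite -subr_eq0; apply/eqP.
  apply: (integral_conj_lt1_eq0 gen s_inj).
    by apply: ring_of_integersB; [case: (HS x xS)|case: (HS y yS)].
  move=> j; rewrite -{1}(cP x).2 -(cP y).2; apply: HA; rewrite ?(cP x).1 ?(cP y).1 //.
  move=> i; have [ni|iln] := leqP n i.
    by rewrite !nth_default ?(leq_trans (cP _).1) // subrr normr0 mulr0 ltr01.
  rewrite -[A]ger0_norm ?ltW // -normrM mulrBr; apply: floor_eq_dist.
  have := congr1 val (E (Ordinal iln)); rewrite !ffunE /=.
  have [a1 a2] := flP x i xS; have [b1 b2] := flP y i yS.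
  move: a1 a2 b1 b2; rewrite -/(fl x i) -/(fl y i); move: (fl x i) (fl y i) => a b a1 a2 b1 b2.
  rewrite !inordK; lia.
have szS : (size S <= (k.*2).+1 ^ n)%N.
  have -> : ((k.*2).+1 ^ n)%N = #|{ffun 'I_n -> 'I_(k.*2).+1}| by rewrite card_ffun !card_ord.
  have /card_uniqP uE : uniq (map idx S) by rewrite map_inj_in_uniq.
  rewrite -(size_map idx) -uE.
  exact: max_card.
apply: (@le_trans _ _ ((k.*2).+1 ^ n)%:R); first by rewrite ler_nat.
have kT : (k.*2).+1%:R <= (2 * A * C + 3) * T.
  rewrite -natr1 -muln2 natrM; have : 0 < A * C by rewrite mulr_gt0.
  by move: kle T1; rewrite -[2 * A * C]mulrA; move: (A * C) => e; nra.
rewrite natrX -exprMn; apply: lerXn2r => //; rewrite nnegrE ?ler0n //.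
by apply: le_trans kT; rewrite ler0n.
Qed.

End Counting.

(** * Upper bound for the search space *)

Lemma term_le_sum (R : realType) (I : finType) (F : I -> R) (j : I) :
  (forall i, 0 <= F i) -> F j <= \sum_i F i.
Proof. by move=> F0; rewrite (bigD1 j) //= lerDl sumr_ge0. Qed.

(** Bounding all finite subfamilies yields finiteness and the bound at once. *)
Lemma finite_of_size_le (R : realType) (T : choiceType) (A : set T) (M : R) :
  (forall S : seq T, uniq S -> (forall x, x \in S -> A x) -> (size S)%:R <= M) ->
  finite_set A /\ (#|` fset_set A|)%:R <= M.
Proof.
move=> H; have finA : finite_set A.
  apply: contrapT => /(infinite_set_fset (Num.truncn M).+1) [B BA cB].
  have := H B (fset_uniq B) (fun x xB => BA x xB); apply/negP; rewrite -ltNge.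
  by apply: lt_le_trans (truncnS_gt M) _; rewrite ler_nat.
split => //; apply: H; first exact: fset_uniq.
by move=> x; rewrite in_fset_set // => /set_mem.
Qed.

Lemma counting_cover_le (R : realType) (T : choiceType) (I : finType) (phi : I -> T) (A : set T) :
  A `<=` range phi -> (counting A <= (#|I|%:R : R)%:E)%E.
Proof.
move=> Aphi.
have [S uS SA|finA cA] := @finite_of_size_le R _ A #|I|%:R; last first.
  by rewrite /counting asboolT // lee_fin.
rewrite ler_nat -(size_codom phi); apply: uniq_leq_size => // x /SA/Aphi[i _ <-].
exact: codom_f.
Qed.

Lemma counting_inj_ge (R : realType) (T : choiceType) (I : finType) (phi : I -> T) (A : set T) :
  injective phi -> (forall i, A (phi i)) -> ((#|I|%:R : R)%:E <= counting A)%E.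
Proof.
move=> inj phiA; rewrite /counting; case: asboolP => [finA|_]; last exact: leey.
rewrite lee_fin ler_nat -(size_codom phi); apply: uniq_leq_size.
  exact/injectiveP.
by move=> x /codomP[i ->]; rewrite in_fset_set //; apply/mem_set/phiA.
Qed.

Section SearchBound.
Variables (R : realType) (K : fieldExtType rat) (theta : K) (f : {poly int}).
Hypothesis gen : integral_power_basis theta f.
Local Notation n := (\dim {:K}).
Variable s : 'I_n -> {rmorphism K -> R[i]}.
Hypothesis s_inj : injective (fun j => s j theta).
Variable eps : 'I_(unit_rank K) -> K.

Lemma ideal_sub (a : set K) x y : nonzero_ideal a -> a x -> a y -> a (x - y).
Proof.
case=> _ _ aD aM _ ax ay; apply: aD => //; rewrite -mulN1r; apply: aM => //.
rewrite -[-1]sub0r; apply: ring_of_integersB.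
- exact: (mxpoly.integral0 (intr : {rmorphism int -> K})).
- exact: (mxpoly.integral1 (intr : {rmorphism int -> K})).
Qed.

(** When O_K / a is infinite, [ideal_norm] is 0 and the family is empty. *)
Lemma coset_reps (a : set K) : nonzero_ideal a -> exists r : 'I_(ideal_norm a) -> K,
  (forall i, ring_of_integers K (r i)) /\ forall i j, a (r i - r j) -> i = j.
Proof.
move=> aI; have [_ a0 aD _ _] := aI.
rewrite /ideal_norm; set Q := [set _ | x in _].
have [finQ|infQ] := pselect (finite_set Q); last first.
  rewrite /fset_set; case: pselect => // _.
  by rewrite cardfs0; exists (fun=> 0); split => -[].
have QP (i : 'I_#|` fset_set Q|) : exists2 x, ring_of_integers K x &
    [set y | a (y - x)] = nth set0 (fset_set Q) i.
  have : nth set0 (fset_set Q) i \in fset_set Q by rewrite mem_nth.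
  by rewrite in_fset_set // => /set_mem[x xO xE]; exists x.
exists (fun i => s2val (cid2 (QP i))); split => [i|i j]; first by case: cid2.
case: cid2 => /= x xO xE; case: cid2 => /= y yO yE axy.
apply/val_inj/eqP; rewrite -(nth_uniq set0 _ _ (fset_uniq (fset_set Q))) ?ltn_ord //.
apply/eqP; rewrite -xE -yE; apply/seteqP; split => z /= h.
  by have -> : z - y = (z - x) + (x - y) by [ring]; apply: aD.
by have -> : z - x = (z - y) - (x - y) by [ring]; apply: (ideal_sub aI).
Qed.

(** The constant is uniform in a: the translates of S by representatives r_i of
    O_K / a are N(a) |S| distinct integers, all in a box of size O((B N(a))^(1/n))
    as soon as (B N(a))^(1/n) dominates the conjugates of the r_i. *)
Lemma search_coords_size_le : exists2 C : R, 1 <= C &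
  forall a : set K, nonzero_ideal a -> exists B0 : R, forall B : R, B0 <= B ->
  forall S : seq K, uniq S -> (forall x, x \in S -> search_coords eps a B x) ->
  (size S)%:R <= C * B.
Proof.
have [C C0 HC] := integers_in_box gen s_inj.
pose V (j : 'I_n) : arch_places R K := exist _ _ (conj_absval s j).
pose E j := expR (Dmax eps (V j) / (local_degree (sval (V j)))%:R).
pose E1 : R := 1 + \sum_j E j.
have E0 j : 0 <= E j by apply: expR_ge0.
have E1_ge j : E j <= E1.
  by apply: le_trans (term_le_sum j E0) _; rewrite /E1 lerDr.
have E1_1 : 1 <= E1 by rewrite lerDl sumr_ge0.
have n0 : (0 < n)%N by apply: dim_gt0.
have C1 : 0 <= C * (E1 + 1) ^+ n by rewrite mulr_ge0 ?exprn_ge0 ?ltW //; lra.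
exists (1 + C * (E1 + 1) ^+ n); first by rewrite lerDl.
move=> a aI; have [r [rO r_inj]] := coset_reps aI.
have [a_O a0 aD aM _] := aI.
set Na := ideal_norm a in r rO r_inj *.
pose T0 : R := 1 + \sum_i \sum_j cabs (s j (r i)).
have sum0 i : 0 <= \sum_j cabs (s j (r i)) by apply: sumr_ge0 => j _; apply: cabs_ge0.
have T01 : 1 <= T0 by rewrite lerDl; apply: sumr_ge0.
have T0r i j : cabs (s j (r i)) <= T0.
  apply: le_trans (term_le_sum (F := fun j => cabs (s j (r i))) j (fun j => cabs_ge0 _)) _.
  by apply: le_trans (term_le_sum i sum0) _; rewrite /T0 lerDr.
exists (T0 ^+ n) => B BT S uS SA.
have B1 : 1 <= B by apply: le_trans BT; rewrite exprn_ege1.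
have Bge0 : 0 <= B by apply: le_trans B1.
have T0ge0 : 0 <= T0 by apply: le_trans T01.
pose T := (B * Na%:R) `^ (n%:R^-1).
have SE x j : x \in S -> cabs (s j x) <= T * E j.
  by move=> /SA[_ H _]; have := H (V j).
(* The value 0 of N(a) leaves only x = 0. *)
have [Na0|Nagt] := posnP Na.
  have S0 x : x \in S -> x = 0.
    move=> xS; have := SE x (Ordinal n0) xS.
    rewrite /T Na0 mulr0 powR0 ?invr_neq0 ?pnatr_eq0 -?lt0n // mul0r.
    move=> h; apply/eqP; rewrite -(fmorph_eq0 (s (Ordinal n0))) -cabs_eq0.
    by rewrite eq_le h cabs_ge0.
  have sS : (size S <= 1)%N.
    by rewrite -[1%N]/(size [:: 0 : K]); apply: uniq_leq_size => // x /S0 ->; rewrite inE.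
  apply: (@le_trans _ _ 1); first by rewrite -[1]/(1%:R) ler_nat.
  by rewrite mulrDl mul1r (le_trans B1) // lerDl mulr_ge0.
have Na1 : 1 <= Na%:R :> R by rewrite ler1n.
have TnE : T ^+ n = B * Na%:R.
  rewrite -powR_mulrn ?powR_ge0 // /T -powRrM mulVf ?pnatr_eq0 -?lt0n //.
  by rewrite powRr1 // mulr_ge0.
have TT0 : T0 <= T.
  rewrite -(@ler_pXn2r _ n) ?nnegrE ?powR_ge0 //.
  by rewrite TnE (le_trans BT) // ler_peMr.
pose L := [seq x + r i | i <- enum 'I_Na, x <- S].
have uL : uniq L.
  apply: allpairs_uniq => //; first exact: enum_uniq.
  move=> [i x] [j y] /allpairsP[[i1 x1] /= [_ xS [-> ->]]] /allpairsP[[j1 y1] /= [_ yS [-> ->]]] H.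
  have ij : i1 = j1.
    apply: r_inj; have -> : r i1 - r j1 = y1 - x1.
      by move: H => /= H; rewrite -(addrK x1 (r i1)) [r i1 + _]addrC H; ring.
    by apply: (ideal_sub aI); [case: (SA y1 yS)|case: (SA x1 xS)].
  by move: H; rewrite ij => /addIr ->.
have szL : size L = (Na * size S)%N by rewrite size_allpairs size_enum_ord.
have := HC ((E1 + 1) * T) L _ uL _; rewrite szL.
have T1 : 1 <= T by apply: le_trans TT0.
have ET1 : 1 <= (E1 + 1) * T by rewrite mulr_ege1 // (le_trans E1_1) // lerDl.
move/(_ ET1) => HL.
have {}HL : (Na * size S)%:R <= C * ((E1 + 1) * T) ^+ n.
  apply: HL => x /allpairsP[[i y] /= [_ yS ->]]; split.
    by apply: ring_of_integersD => //; apply: a_O; case: (SA y yS).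
  move=> j; rewrite rmorphD /=; apply: le_trans (cabsD _ _) _.
  rewrite mulrDl mul1r lerD ?(le_trans (T0r i j)) // (le_trans (SE y j yS)) //.
  by rewrite mulrC ler_wpM2r ?powR_ge0.
rewrite exprMn TnE natrM in HL.
have {HL} : Na%:R * (size S)%:R <= Na%:R * (C * (E1 + 1) ^+ n * B).
  by move: HL; rewrite !mulrA [X in _ <= X]mulrC !mulrA.
rewrite ler_pM2l ?ltr0n // => /le_trans; apply.
by rewrite ler_wpM2r ?lerDr.
Qed.

Lemma counting_search_space_ideal_le N : exists2 C : R, 1 <= C &
  forall a : set K, nonzero_ideal a -> exists B0 : R, forall B : R, B0 <= B ->
    (counting (search_space_ideal N eps a B) <= (C * B ^+ N.+1)%:E)%E.
Proof.
have [C C1 HC] := search_coords_size_le.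
exists (C ^+ N.+1); first by rewrite exprn_ege1.
move=> a /HC [B0 HB]; exists B0 => B /HB H.
have [finA cA] := finite_of_size_le H.
set A := search_coords eps a B in finA cA.
pose phi (c : {ffun 'I_N.+1 -> fset_set A}) := proj_point (\row_i val (c i)).
apply: (@le_trans _ _ (#|{ffun 'I_N.+1 -> fset_set A}|%:R : R)%:E).
  apply: counting_cover_le (phi) _ _ => _ [x [x0 xA] <-].
  have xA' i : x 0 i \in fset_set A by rewrite in_fset_set //; apply/mem_set/xA.
  exists [ffun i => [` xA' i]%fset] => //; rewrite /phi; congr proj_point.
  by apply/rowP => i; rewrite mxE ffunE.
rewrite lee_fin card_ffun card_ord -cardfE natrX -exprMn.
by apply: lerXn2r => //; rewrite nnegrE ?ler0n //; apply: le_trans cA.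
Qed.

End SearchBound.

(** * Local degrees and the height of an integral point *)

Lemma cvg_sum_seq (R : realType) (I : Type) (r : seq I) (u : I -> nat -> R) (l : I -> R) :
  (forall i, u i @ \oo --> l i) ->
  (fun t => \sum_(i <- r) u i t) @ \oo --> \sum_(i <- r) l i.
Proof.
move=> ul; elim: r => [|i r IH].
  by under eq_fun do rewrite big_nil; rewrite big_nil; apply: cvg_cst.
by under eq_fun do rewrite big_cons; rewrite big_cons; apply: cvgD.
Qed.

Lemma cvg0P (R : realType) (u : nat -> R) : u @ \oo --> 0 <->
  forall e : R, 0 < e -> exists M, forall i, (M <= i)%N -> `|u i| < e.
Proof.
split=> [/cvgrPdist_lt H e /H[M _ HM]|H].
  by exists M => i Mi; have := HM i Mi; rewrite /= sub0r normrN.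
apply/cvgrPdist_lt => e /H[M HM]; exists M => // i Mi /=.
by rewrite sub0r normrN; apply: HM.
Qed.

Lemma cauchy_has_limit (R : realType) (u : nat -> R) :
  (forall e : R, 0 < e -> exists M, forall i j, (M <= i)%N -> (M <= j)%N -> `|u i - u j| < e) ->
  exists l : R, u @ \oo --> l.
Proof.
move=> H; suff h : cvgn u by exists (limn u).
apply: cauchy_cvg; apply: cauchy_exP => e /H[M HM]; exists (u M).
by exists M => // i Mi /=; rewrite -ball_normE /=; apply: HM.
Qed.

Lemma rat_approx (R : realType) (c : R) : exists q : nat -> rat, (ratr \o q : nat -> R) @ \oo --> c.
Proof.
have H t : exists q : rat, `|ratr q - c| < t.+1%:R^-1.
  have lt : c - t.+1%:R^-1 < c + t.+1%:R^-1.
    have : 0 < t.+1%:R^-1 :> R by rewrite invr_gt0 ltr0Sn.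
    by move: (t.+1%:R^-1) => w; lra.
  have [q] := rat_in_itvoo lt; rewrite in_itv /= => /andP[q1 q2]; exists q.
  by rewrite ltr_distl; apply/andP.
exists (fun t => sval (cid (H t))); apply/cvgrPdist_lt => e e0.
have /cvgrPdist_lt/(_ _ e0)[M _ HM] := @cvg_harmonic R.
exists M => // t Mt /=; have := HM t Mt; rewrite /= sub0r normrN => he.
case: cid => /= q hq; rewrite distrC; apply: lt_trans hq _.
by apply: le_lt_trans he; apply: ler_norm.
Qed.

(** The coordinates phi embed the completion of K at v in a real space of dimension
    m.  If d > m, the limits of the basis elements satisfy a real linear relation;
    approximating its coefficients by rational sequences gives a null combination of
    the basis whose coefficients do not tend to 0. *)
Lemma local_basis_size_le (R : realType) (K : fieldExtType rat) (v : K -> R) m (phi : 'I_m -> K -> R) :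
  arch_place v ->
  (forall k x y, phi k (x + y) = phi k x + phi k y) ->
  (forall k (q : rat) x, phi k (q%:A * x) = ratr q * phi k x) ->
  (forall k x, `|phi k x| <= v x) -> (forall x, v x <= \sum_k `|phi k x|) ->
  forall d (b : 'I_d -> nat -> K), local_basis v b -> (d <= m)%N.
Proof.
move=> [vP vQ] phiD phiZ phi_le le_phi d b [b_cauchy _ b_free].
rewrite leqNgt; apply/negP => md.
have phi0 k : phi k 0 = 0 by apply: (addrI (phi k 0)); rewrite -phiD !addr0.
have phiB k x y : phi k (x - y) = phi k x - phi k y.
  by apply/eqP; rewrite -subr_eq opprK -phiD subrK.
have phi_sum k (F : 'I_d -> K) : phi k (\sum_i F i) = \sum_i phi k (F i).
  elim/big_rec2: _ => // i y1 y2 _ <-; exact: phiD.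
have lim (i : 'I_d) (k : 'I_m) : exists l : R, (fun t => phi k (b i t)) @ \oo --> l.
  apply: cauchy_has_limit => e /(b_cauchy i)[M HM]; exists M => t t' Mt Mt'.
  by rewrite -phiB; apply: le_lt_trans (phi_le _ _) (HM _ _ Mt Mt').
pose beta : 'M[R]_(d, m) := \matrix_(i, k) sval (cid (lim i k)).
have betaP i k : (fun t => phi k (b i t)) @ \oo --> beta i k by rewrite mxE; case: cid.
have : kermx beta != 0.
  by rewrite -mxrank_eq0 mxrank_ker -lt0n subn_gt0 (leq_ltn_trans (rank_leq_col _)).
case/rowV0Pn => c /sub_kermxP cb c0.
pose q i := sval (cid (rat_approx (c 0 i))).
have qP i : (fun t => ratr (q i t)) @ \oo --> c 0 i by rewrite /q; case: cid.
(* The q_i tend to the coefficients of a real relation between the limits beta_i. *)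
have q_cauchy i : v_cauchy v (fun t => (q i t)%:A).
  move=> e e0; have e2 : 0 < e / 2 by rewrite divr_gt0.
  have /cvgrPdist_lt/(_ _ e2)[M _ HM] := qP i.
  exists M => t t' Mt Mt'; rewrite -scalerBl vQ rmorphB /=.
  have := HM t Mt; have := HM t' Mt'; rewrite /=.
  rewrite !ltr_norml => /andP[h1 h2] /andP[h3 h4].
  by apply/andP; split; lra.
have q_null : v_null v (fun t => \sum_(i < d) (q i t)%:A * b i t).
  have : (fun t => \sum_k `|phi k (\sum_(i < d) (q i t)%:A * b i t)|) @ \oo --> (0 : R).
    have z : \sum_(k < m) (0 : R) = 0 by rewrite big1.
    rewrite -[X in _ --> X]z; apply: cvg_sum_seq => k.
    rewrite -[X in _ --> X](normr0 R); apply: cvg_norm.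
    have {}z : \sum_i c 0 i * beta i k = 0 by have /rowP/(_ k) := cb; rewrite !mxE.
    rewrite -[X in _ --> X]z.
    under eq_fun do rewrite phi_sum; apply: cvg_sum_seq => i.
    by under eq_fun do rewrite phiZ; apply: cvgM.
  move/cvg0P => H e /H[M HM]; exists M => t Mt.
  apply: le_lt_trans (HM t Mt); apply: le_trans (le_phi _) _; exact: ler_norm.
have := b_free _ q_cauchy q_null => {}b_free.
move/eqP: c0; apply; apply/rowP => i; rewrite mxE.
apply: (cvg_unique _ (qP i)) => //; apply/cvg0P => e /(b_free i)[M HM].
by exists M => t /HM; rewrite vQ.
Qed.

Section Height.
Variables (R : realType) (K : fieldExtType rat) (theta : K) (f : {poly int}).
Hypothesis gen : integral_power_basis theta f.
Local Notation n := (\dim {:K}).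
Variable s : 'I_n -> {rmorphism K -> R[i]}.
Hypothesis s_inj : injective (fun j => s j theta).
Hypothesis s_conj : forall j, exists j', forall x, s j' x = (s j x)^*%C.

Definition conj_fiber (v : K -> R) : {set 'I_n} :=
  [set j | `[< forall x, v x = cabs (s j x) >]]%SET.

Lemma local_degree_le_dim (v : K -> R) m (phi : 'I_m -> K -> R) :
  arch_place v ->
  (forall k x y, phi k (x + y) = phi k x + phi k y) ->
  (forall k (q : rat) x, phi k (q%:A * x) = ratr q * phi k x) ->
  (forall k x, `|phi k x| <= v x) -> (forall x, v x <= \sum_k `|phi k x|) ->
  (local_degree v <= m)%N.
Proof.
move=> vA phiD phiZ phi_le le_phi; rewrite /local_degree; case: xgetP => [d _ /= [b]|_ //].
exact: (local_basis_size_le vA phiD phiZ phi_le le_phi).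
Qed.

Lemma Re_D (z w : R[i]) : complex.Re (z + w) = complex.Re z + complex.Re w.
Proof. by case: z w => a b [c d]. Qed.
Lemma Im_D (z w : R[i]) : complex.Im (z + w) = complex.Im z + complex.Im w.
Proof. by case: z w => a b [c d]. Qed.
Lemma ratrC (q : rat) : (ratr q : R[i]) = Complex (ratr q) 0.
Proof. by rewrite -[RHS]/((ratr q : R)%:C%C) fmorph_rat. Qed.
Lemma Re_Z (q : rat) (z : R[i]) : complex.Re (ratr q * z) = ratr q * complex.Re z.
Proof. by rewrite ratrC; case: z => a b /=; rewrite mul0r subr0. Qed.
Lemma Im_Z (q : rat) (z : R[i]) : complex.Im (ratr q * z) = ratr q * complex.Im z.
Proof. by rewrite ratrC; case: z => a b /=; rewrite mul0r addr0. Qed.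

(** The real and imaginary parts of sigma_j embed the completion in a real plane.
    When the conjugate embedding is sigma_j itself, the real part is enough;
    otherwise both sigma_j and its conjugate induce v. *)
Lemma local_degree_le_fiber (v : K -> R) : arch_place v ->
  (local_degree v <= #|conj_fiber v|)%N.
Proof.
move=> vA; have [j vj] := arch_place_conj gen s_inj vA.
have jJ : j \in conj_fiber v by rewrite inE; apply/asboolP.
have sZ i (q : rat) x : s i (q%:A * x) = ratr q * s i x.
  by rewrite rmorphM /=; congr (_ * _); apply: (fmorph_eq_rat (s i \o in_alg K)).
have [j' sj'] := s_conj j.
have j'J : j' \in conj_fiber v.
  by rewrite inE; apply/asboolP => x; rewrite sj' cabs_conj.
have [jj'|jj'] := eqVneq j j'; last first.
  have d2 : (local_degree v <= 2)%N.
    pose phi (k : 'I_2) x := if k == 0 then complex.Re (s j x) else complex.Im (s j x).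
    apply: (@local_degree_le_dim v 2 phi vA).
    - by move=> k x y; rewrite /phi rmorphD; case: ifP => _; rewrite ?Re_D ?Im_D.
    - by move=> k q x; rewrite /phi sZ; case: ifP => _; rewrite ?Re_Z ?Im_Z.
    - by move=> k x; rewrite /phi vj; case: ifP => _; rewrite ?cabs_ge_Re ?cabs_ge_Im.
    - by move=> x; rewrite vj big_ord_recl big_ord1 /phi /=; apply: cabs_le_ReIm.
  apply: leq_trans d2 _.
  have <- : #|[set j; j']%SET| = 2%N by rewrite cards2 jj'.
  by apply: subset_leq_card; apply/fintype.subsetP => i; rewrite in_set2 => /orP[] /eqP->.
have Im0 x : complex.Im (s j x) = 0.
  by have := sj' x; rewrite -jj'; case: (s j x) => a b [] /eqP; rewrite -addr_eq0 -mulr2n mulrn_eq0 => /eqP.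
apply: (@leq_trans 1); last by apply/card_gt0P; exists j.
apply: (@local_degree_le_dim v 1 (fun _ x => complex.Re (s j x)) vA).
- by move=> _ x y; rewrite rmorphD Re_D.
- by move=> _ q x; rewrite sZ Re_Z.
- by move=> _ x; rewrite vj cabs_ge_Re.
- by move=> x; rewrite vj big_ord1; apply: le_trans (cabs_le_ReIm _) _; rewrite Im0 normr0 addr0.
Qed.

(** The sets of embeddings that induce distinct places are disjoint. *)
Lemma sum_local_degree (X : seq (K -> R)) : uniq X ->
  (\sum_(v <- X | `[< arch_place v >]) local_degree v <= n)%N.
Proof.
move=> uX; apply: (@leq_trans (\sum_(v <- X) #|conj_fiber v|)).
  rewrite big_mkcond /=; apply: leq_sum => v _; case: asboolP => // vA.
  exact: local_degree_le_fiber.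
under eq_bigr do rewrite -sum1_card big_mkcond /=.
rewrite exchange_big /= -[X in (_ <= X)%N]card_ord -sum1_card.
apply: leq_sum => j _; rewrite -big_mkcond /= sum1_count.
rewrite (@eq_count _ _ (pred1 (fun x => cabs (s j x)))).
  by rewrite count_uniq_mem // leq_b1.
move=> v; rewrite /= inE; apply/asboolP/eqP => [h|-> //]; exact: funext.
Qed.

(** A p-adic absolute value is at most 1 on the rational integers, and the powers of x
    are combinations of finitely many of them with coefficients in Z; so v(x)^k is
    bounded. *)
Lemma finite_place_integer (v : K -> R) (x : K) : finite_place v -> ring_of_integers K x -> v x <= 1.
Proof.
move=> [vP [p [p_prime vQ]]] xO.
have vZ (m : int) : v m%:~R <= 1.
  have -> : (m%:~R : K) = (m%:~R)%:A by rewrite scaler_int.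
  rewrite vQ /padic_abs; case: ifP => // _; rewrite numq_int denq_int /= logn1 sub0r.
  by rewrite -exprnN invf_le1 ?exprn_gt0 ?ltr0n ?prime_gt0 // exprn_ege1 // ler1n prime_gt0.
have [m Hm] := integral_power_reduction xO.
apply: (@le_of_expr_le _ _ _ (\sum_(i < m) v x ^+ i)) => // [|k]; first exact: absval_ge0.
have [r xk] := Hm k; rewrite expr1n mulr1 -absvalX // xk.
apply: le_trans (absval_sum vP _ _ _) _; apply: ler_sum => i _.
by rewrite absvalM // absvalX // ler_piMl ?exprn_ge0 ?absval_ge0.
Qed.

(** Finite places contribute at most 1, and the exponents n_v of T add up to at most
    n.  When the product has infinite support its value is 1, which also satisfies the
    bound. *)
Lemma height_le N (x : 'rV[K]_N.+1) (T : R) : 1 <= T ->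
  (forall i, ring_of_integers K (x 0 i)) -> (forall i j, cabs (s j (x 0 i)) <= T) ->
  height R x <= T ^+ n.
Proof.
move=> T1 xO xT; rewrite /height.
case: finite_supportP => [_|X XP _ _]; first by rewrite big_nil exprn_ege1.
apply: (@le_trans _ _ (\prod_(v <- X) (if `[< arch_place v >] then T ^+ local_degree v else 1))).
  rewrite big_seq [X in _ <= X]big_seq; apply: ler_prod => v vX.
  rewrite bigmax_ge_id /=; apply/bigmax_leP; split.
    by case: asboolP => _ //; rewrite exprn_ge0 // (le_trans _ T1).
  move=> i _; rewrite /norm_v; case: asboolP => [vA|nA].
    have := arch_le_conj gen s_inj vA (xT i).
    move=> h; apply: lerXn2r => //; rewrite nnegrE; last by apply: le_trans T1.
    by apply: absval_ge0; case: vA.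
  case: (XP v vX) => // vF; rewrite exprn_ile1 ?finite_place_integer //.
  by rewrite absval_ge0 //; case: vF.
rewrite -big_mkcond /= prodrXr.
by apply: ler_weXn2l => //; apply: sum_local_degree; apply: fset_uniq.
Qed.

End Height.

(** * Unimodular pairs in Z[X] modulo f *)

Lemma lift_Fp (p : nat) (u : {poly 'F_p}) :
  exists w : {poly int}, map_poly intr w = u.
Proof.
exists (map_poly (fun x : 'F_p => (val x)%:Z) u); apply/polyP => i.
rewrite coef_map /= coef_map_id0 //.
by rewrite -pmulrn natr_Zp.
Qed.

(** The ideals Z_i consist of the integer polynomials that vanish at the i-th root of f
    in an algebraic closure of F_p: they are the prime ideals above p of Z[X] / (f),
    possibly repeated.  If no Z_i contains both a and b, then a, b and f have no
    common factor modulo p, and Bezout coefficients modulo p lift to Z. *)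
Lemma prime_ideals_above (f : {poly int}) (n p : nat) :
  f \is monic -> size f = n.+1 -> prime p ->
  exists Z : 'I_n -> pred {poly int}, 
  [/\ forall i, Z i f,
      forall i a b, Z i a -> Z i b -> Z i (a - b),
      forall i u a, Z i a -> Z i (u * a),
      forall i (m : int), Z i m%:P = (p %| m)%Z
    & forall a b, (forall i, ~~ (Z i a && Z i b)) ->
      exists u v w z, u * a + v * b + w * f + z * (p%:Z)%:P = 1].
Proof.
move=> mon_f szf p_prime.
have [Om [iota _]] := countable_algebraic_closure 'F_p.
pose red : {rmorphism {poly int} -> {poly 'F_p}} := map_poly intr.
have redE (a : {poly int}) : map_poly (intr : int -> Om) a = map_poly iota (red a).
  rewrite /red -map_poly_comp; apply: eq_map_poly => m /=.
  by rewrite rmorph_int.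
have mon_rf : red f \is monic by apply: monic_map.
have [r fr] := closed_field_poly_normal (map_poly (intr : int -> Om) f).
rewrite (monicP (monic_map _ mon_f)) scale1r in fr.
have szr : size r = n.
  apply/eqP; rewrite -eqSS -szf -(size_prod_XsubC r id) -fr.
  by rewrite redE size_map_poly size_map_poly_id0 ?(monicP mon_f) ?rmorph1 ?oner_eq0.
exists (fun i a => root (map_poly (intr : int -> Om) a) r`_i); split.
- by move=> i; rewrite fr root_prod_XsubC mem_nth // szr.
- by move=> i a b /rootP a0 /rootP b0; rewrite rmorphB /= rootE hornerD hornerN a0 b0 subr0.
- by move=> i u a /rootP a0; rewrite rmorphM /= rootE hornerM a0 mulr0.
- move=> i m; rewrite map_polyC /= rootE hornerC (dvdz_pcharf (p := p) (R := Om)) //.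
  have -> : [pchar Om] =i [pchar 'F_p] by apply: fmorph_pchar iota.
  exact: pchar_Fp.
move=> a b ab.
have cop : coprimep (gcdp (red a) (red b)) (red f).
  rewrite /coprimep; apply/negPn/negP => sg.
  set g := gcdp _ _ in sg.
  have [t gt] : exists t, root (map_poly iota g) t by apply/closed_rootP; rewrite size_map_poly.
  have /andP[gab gf] : (g %| gcdp (red a) (red b)) && (g %| red f) by rewrite -dvdp_gcd.
  move: gab; rewrite dvdp_gcd => /andP[ga gb].
  have rt h : g %| h -> root (map_poly iota h) t.
    by move=> /dvdpP[k ->]; rewrite rmorphM rootM gt orbT.
  have tr : t \in r by rewrite -root_prod_XsubC -fr redE rt.
  have [i ltin rti] := nthP 0 tr; rewrite szr in ltin.
  by have := ab (Ordinal ltin); rewrite /= rti !redE !rt.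
have /Bezout_eq1_coprimepP [[u v] /= uv] := cop.
have [[u1 v1] /= ] := Bezoutp (red a) (red b).
move=> /eqpP[[c d] /andP[/= c0 d0] E].
have gE : gcdp (red a) (red b) = (d^-1 * c) *: (u1 * red a + v1 * red b).
  by rewrite -scalerA E scalerA mulVf // scale1r.
have [U UE] := lift_Fp ((d^-1 * c) *: (u * u1)).
have [V VE] := lift_Fp ((d^-1 * c) *: (u * v1)).
have [W WE] := lift_Fp v.
have : red (1 - (U * a + V * b + W * f)) = 0.
  rewrite rmorphB rmorph1 !rmorphD !rmorphM /= UE VE WE -uv gE.
  rewrite -!mul_polyC; ring.
move=> /polyP H; pose d1 := 1 - (U * a + V * b + W * f).
exists U, V, W, (map_poly (fun m => (m %/ p)%Z) d1).
suff -> : map_poly (fun m => (m %/ p)%Z) d1 * (p%:Z)%:P = d1 by rewrite /d1; ring.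
apply/polyP => i; rewrite coefMC coef_map_id0 ?div0z // divzK //.
rewrite (dvdz_pcharf (pchar_Fp p_prime)).
by have := H i; rewrite coef_map coef0 => ->.
Qed.

(** If I = (a, b, f) contains m > 0 and I + (p) is the unit ideal for each prime p that
    divides m, then I + (m) = I is the unit ideal: multiply the relations for the prime
    factors of m. *)
Lemma unit_ideal_of_primes (f a b g w : {poly int}) (m : nat) :
  (0 < m)%N -> g * f + w * a = (m%:Z)%:P ->
  (forall p, prime p -> (p %| m)%N -> exists u v w z, u * a + v * b + w * f + z * (p%:Z)%:P = 1) ->
  exists u v w, u * a + v * b + w * f = 1.
Proof.
move=> m0 mE H.
have [u [v [w' [z]]]] : exists u v w z, u * a + v * b + w * f + z * (m%:Z)%:P = 1.
  move: m0 H {mE}; elim/ltn_ind: m => m IH m0 H.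
  have [->|m1] := eqVneq m 1%N; first by exists 0, 0, 0, 1; rewrite polyC1; ring.
  have {}m1 : (1 < m)%N by lia.
  have p_prime := pdiv_prime m1; set p := pdiv m in p_prime.
  have pm : (p %| m)%N := pdiv_dvd m.
  have [u1 [v1 [w1 [z1 E1]]]] := H p p_prime pm.
  have [|||u2 [v2 [w2 [z2 E2]]]] := IH (m %/ p)%N.
  - by rewrite ltn_Pdiv // prime_gt1.
  - by rewrite divn_gt0 ?prime_gt0 // dvdn_leq.
  - by move=> q q_prime qm; apply: H => //; apply: dvdn_trans qm (dvdn_div pm).
  pose X2 := u2 * a + v2 * b + w2 * f + z2 * ((m %/ p)%N%:Z)%:P.
  pose P1 := z1 * (p%:Z)%:P.
  exists (u1 * X2 + P1 * u2), (v1 * X2 + P1 * v2), (w1 * X2 + P1 * w2), (z1 * z2).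
  have -> : (m%:Z)%:P = (p%:Z)%:P * ((m %/ p)%N%:Z)%:P :> {poly int}.
    by rewrite -polyCM -PoszM mulnC divnK.
  rewrite -[RHS](mulr1 1) -[in X in _ = X * _]E1 -[in X in _ = _ * X]E2 /X2 /P1; ring.
rewrite -mE => E; exists (u + z * w), v, (w' + z * g); rewrite -E; ring.
Qed.

Lemma det_le (d : nat) (A : 'M[int]_d) (W : int) : (forall i j, `|A i j| <= W) ->
  `|\det A| <= (d`!)%:Z * W ^+ d.
Proof.
move=> AW; apply: le_trans (ler_norm_sum _ _ _) _.
have -> : (d`!)%:Z * W ^+ d = \sum_(s : 'S_d) W ^+ d.
  by rewrite sumr_const card_Sn -mulr_natl natz.
apply: ler_sum => s _.
rewrite normrM normrX normrN1 expr1n mul1r normr_prod.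
rewrite -[X in W ^+ X](card_ord d) -prodr_const; apply: ler_prod => i _.
by rewrite normr_ge0 AW.
Qed.

(** The integer is the resultant of f and a up to sign, or a itself when a is
    constant; the resultant is nonzero since f and a are coprime over Q.  The crude estimate by Leibniz's formula is enough, because only the
    number of large prime factors matters. *)
Lemma small_integer_in_ideal (f a : {poly int}) (n : nat) (W : int) :
  f \is monic -> size f = n.+1 -> (0 < n)%N -> (size a <= n)%N -> a != 0 ->
  coprimep (map_poly (intr : int -> rat) f) (map_poly intr a) ->
  (forall i, `|f`_i| <= W) -> (forall i, `|a`_i| <= W) -> 1 <= W ->
  exists (m : nat) (g w : {poly int}), [/\ (0 < m)%N, g * f + w * a = (m%:Z)%:P
    & m%:Z <= ((n.*2)`!)%:Z * W ^+ n.*2].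
Proof.
move=> mon_f szf n0 sa a0 cop fW aW W1.
suff [m [g [w [m0 E mW]]]] : exists (m : int) (g w : {poly int}), [/\ m != 0,
   g * f + w * a = m%:P & `|m| <= ((n.*2)`!)%:Z * W ^+ n.*2].
  exists `|m|%N, (Num.sg m *: g), (Num.sg m *: w); split => //.
  - by rewrite absz_gt0.
  - by rewrite -!scalerAl -scalerDr E -mul_polyC -polyCM -normrEsg abszE.
have WX (k : nat) : 1 <= W ^+ k by rewrite exprn_ege1.
have [sa1|sa1] := leqP (size a) 1.
  have [c ac] : exists c, a = c%:P by exists (a`_0); apply: size1_polyC.
  exists c, 0, 1; split; [|by rewrite ac; ring|].
    by move: a0; rewrite ac polyC_eq0.
  have := aW 0; rewrite ac coefC eqxx => /le_trans; apply.
  apply: (@le_trans _ _ (1 * W ^+ n.*2)).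
    by rewrite mul1r ler_eXnr // double_gt0.
  by rewrite ler_wpM2r ?(le_trans _ (WX _)) // lez_nat fact_gt0.
have sf1 : (1 < size f)%N by rewrite szf ltnS.
have [[g w] /= _ E] := resultant_in_ideal sf1 sa1.
exists (resultant f a), g, w; split => //.
  rewrite resultant_eq0 -leqNgt; set h := gcdp f a.
  have dvdQ (q : {poly int}) : h %| q -> map_poly (intr : int -> rat) h %| map_poly intr q.
    case/Pdiv.Idomain.dvdpP => [[c k] /= c0 E']; rewrite -(dvdpZr _ _ (_ : c%:~R != 0)) ?intr_eq0 //.
    have -> : c%:~R *: map_poly intr q = map_poly (intr : int -> rat) (c *: q).
      by rewrite -!mul_polyC rmorphM /= map_polyC.
    by rewrite E' rmorphM dvdp_mull.
  have := dvdpp (map_poly (intr : int -> rat) h).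
  have hab : map_poly (intr : int -> rat) h %| gcdp (map_poly intr f) (map_poly intr a).
    by rewrite dvdp_gcd !dvdQ ?dvdp_gcdl ?dvdp_gcdr.
  move: (eqP cop) => /eqP; rewrite size_poly_eq1 => /eqp_dvdr g1 _.
  move: hab; rewrite g1 dvdp1 size_map_inj_poly ?rmorph0 // => [/eqP->//|]; exact: intr_inj.
apply: le_trans (det_le (W := W) _) _ => [i j|].
  rewrite Sylvester_mxE; case: (fintype.split _) => k; case: (k <= j)%N;
  by rewrite ?mulr1n ?fW ?aW // mulr0n normr0 (le_trans _ W1).
have le_d : ((size a).-1 + (size f).-1 <= n.*2)%N by rewrite szf -addnn /= leq_add2r (leq_trans (leq_pred _)).
apply: ler_pM => //.
- by apply: le_trans (WX _).
- by rewrite lez_nat leq_fact.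
- by rewrite ler_weXn2l.
Qed.

(** * Most pairs in a box are unimodular *)

(** Comparison with the telescoping sum of 1/k - 1/(k+1). *)
Lemma sum_inv_sqr (a b : nat) : (0 < a)%N -> (a <= b)%N ->
  \sum_(p < b.+1 | (a < p)%N) (p%:R ^- 2 : rat) <= a%:R^-1 - b%:R^-1.
Proof.
move=> a0; elim: b => [|b IH]; first by rewrite leqn0 => /eqP h; rewrite h in a0.
rewrite leq_eqVlt => /orP[/eqP <-|].
  by rewrite subrr big_pred0 // => p; rewrite ltnNge -ltnS ltn_ord.
rewrite ltnS => ab; rewrite big_mkcond big_ord_recr -big_mkcond /= ltnS ab.
have b0 : (0 < b)%N by apply: leq_trans ab.
have H : (b.+1%:R ^- 2 : rat) <= b%:R^-1 - b.+1%:R^-1.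
  have b1 : 0 < (b%:R : rat) by rewrite ltr0n.
  have -> : (b%:R^-1 - b.+1%:R^-1 : rat) = (b%:R * b.+1%:R)^-1.
    by rewrite -natr1; field; rewrite ?gt_eqF // -?natr1 ?ltr_wpDr.
  rewrite lef_pV2 ?posrE ?exprn_gt0 ?mulr_gt0 ?ltr0Sn // expr2.
  by rewrite ler_wpM2r // ler_nat.
by apply: le_trans (lerD (IH ab) H) _; rewrite addrA subrK.
Qed.

(** The product of distinct primes dividing m divides m. *)
Lemma large_primes_count (m T : nat) : (0 < m)%N ->
  (T ^ count (fun p => T < p)%N (primes m) <= m)%N.
Proof.
move=> m0; rewrite [X in (_ <= X)%N](prod_prime_decomp m0) prime_decompE big_map /=.
rewrite -sum1_count expn_sum big_mkcond /= big_seq [X in (_ <= X)%N]big_seq.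
apply: leq_prod => p; rewrite mem_primes => /and3P[p_prime _ pm].
have lp : (0 < logn p m)%N by rewrite logn_gt0 mem_primes p_prime m0.
case: ifP => [Tp|_]; last by rewrite expn_gt0 prime_gt0.
by rewrite expn1 (leq_trans (ltnW Tp)) // -{1}[p]expn1 leq_pexp2l // prime_gt0.
Qed.

Section CoprimePairs.
Variables (f : {poly int}) (n' : nat).
Local Notation n := n'.+1.
Hypotheses (mon_f : f \is monic) (szf : size f = n.+1).
Hypothesis cop_f : forall a : {poly rat}, (size a <= n)%N -> a != 0 ->
  coprimep (map_poly intr f) a.

Definition box (T : nat) := {ffun 'I_n -> 'I_T}.

Definition box_poly (T : nat) (c : box T) : {poly int} :=
  \poly_(i < n) (c (inord i) : nat)%:Z.

(** The integers x of the overview: 1 + M (L T + sum_i c_i theta^i) with 0 <= c_i < T.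
    The term M L T dominates when L is large, so that all conjugates of all these
    elements are close to each other. *)
Definition box_point (M L T : nat) (c : box T) : {poly int} :=
  1 + (M%:Z)%:P * (((L * T)%N%:Z)%:P + box_poly c).

Lemma coef_box_poly T (c : box T) (i : 'I_n) : (box_poly c)`_i = (c i : nat)%:Z.
Proof. by rewrite coef_poly ltn_ord inord_val. Qed.

Lemma size_box_point M L T (c : box T) : (size (box_point M L c) <= n)%N.
Proof.
rewrite /box_point mul_polyC (leq_trans (size_polyD _ _)) // geq_max size_poly1 /=.
rewrite (leq_trans (size_scale_leq _ _)) // (leq_trans (size_polyD _ _)) // geq_max.
by rewrite (leq_trans (size_polyC_leq1 _)) //= size_poly.
Qed.

Lemma coef_box_point M L T (c : box T) i :
  0 <= (box_point M L c)`_i <= 1 + (M * (L * T + T))%N%:Z.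
Proof.
rewrite /box_point coefD coefCM coefD coef1 coefC coef_poly.
have [iln|] := ltnP i n; last by case: i => //= i _; rewrite !addr0 mulr0.
have := ltn_ord (c (inord i)); move: (c (inord i) : nat) => x xT.
case: i iln => [|i] _ /=; nia.
Qed.

Lemma box_point_neq0 M L T (c : box T) : box_point M L c != 0.
Proof.
apply/eqP => /polyP/(_ 0); rewrite /box_point coefD coefCM coefD coef1 coefC coef_poly ltn0Sn !eqxx coef0.
rewrite -(PoszD (L * T)) -(PoszM M); move: (M * _)%N => k; lia.
Qed.

Lemma card_box T : #|{: box T}| = (T ^ n)%N.
Proof. by rewrite card_ffun !card_ord. Qed.

(** Fixing the coordinates c_i with i > 0, membership in Z determines M c_0 modulo p,
    hence c_0 modulo p. *)
Lemma card_box_ideal (Z : pred {poly int}) (p M L T : nat) :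
  (forall a b, Z a -> Z b -> Z (a - b)) -> (forall u a, Z a -> Z (u * a)) ->
  (forall m : int, Z m%:P = (p %| m)%Z) -> prime p -> ~~ (p %| M)%N ->
  (#|[pred c : box T | Z (box_point M L c)]| <= T ^ n' * (T %/ p).+1)%N.
Proof.
move=> ZB ZM ZC p_prime pM.
pose F (c : box T) : {ffun 'I_n' -> 'I_T} * 'I_(T %/ p).+1 :=
  ([ffun i => c (lift ord0 i)], inord (c ord0 %/ p)).
have <- : #|{: {ffun 'I_n' -> 'I_T} * 'I_(T %/ p).+1}| = (T ^ n' * (T %/ p).+1)%N.
  by rewrite card_prod card_ffun !card_ord.
apply: (@leq_card_in _ _ F) => c d; rewrite !inE => Zc Zd [/ffunP E0 /(congr1 val) /=].
have div_le (e : box T) : (e ord0 %/ p < (T %/ p).+1)%N.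
  by rewrite ltnS leq_div2r // ltnW.
rewrite !inordK // => E1.
have El (i : 'I_n') : c (lift ord0 i) = d (lift ord0 i) by have := E0 i; rewrite !ffunE.
have : Z ((M%:Z * ((c ord0 : nat)%:Z - (d ord0 : nat)%:Z))%:P).
  have -> : (M%:Z * ((c ord0 : nat)%:Z - (d ord0 : nat)%:Z))%:P = box_point M L c - box_point M L d.
    rewrite /box_point polyCM polyCB.
    have -> : (c ord0 : nat)%:Z%:P - (d ord0 : nat)%:Z%:P = box_poly c - box_poly d.
      apply/polyP => i; rewrite !coefB !coefC !coef_poly; case: i => [|i] /=.
        by have -> : inord 0 = ord0 :> 'I_n by apply: val_inj; rewrite /= inordK.
      case: ltnP => // iln; have -> : inord i.+1 = lift ord0 (Ordinal (iln : i < n')%N) :> 'I_n.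
        by apply: val_inj; rewrite /= inordK.
      by rewrite El !subrr.
    ring.
  exact: ZB.
rewrite ZC dvdzE abszM Euclid_dvdM // (negPf pM) /= => Hp.
have E2 : c ord0 = d ord0.
  apply: val_inj => /=; have := divn_eq (c ord0) p; have := divn_eq (d ord0) p.
  rewrite E1; move: Hp.
  have p0 := prime_gt0 p_prime.
  have := ltn_pmod (c ord0) p0; have := ltn_pmod (d ord0) p0.
  move: (c ord0 : nat) (d ord0 : nat) => x y.
  move: (x %% p)%N (y %% p)%N (y %/ p)%N => r1 r2 q h2 h1 hp e2 e1.
  move: hp; rewrite e1 e2 => hp.
  have {}hp : (p %| `|r1%:Z - r2%:Z|)%N.
    by move: hp; congr (_ %| absz _)%N; lia.
  have [h0|h0] := posnP `|r1%:Z - r2%:Z|%N; first by lia.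
  have := dvdn_leq h0 hp; lia.
apply/ffunP => i; case: (unliftP ord0 i) => [j ->|->] //.
Qed.

Definition unimodular (a b : {poly int}) : Prop :=
  exists u v w, u * a + v * b + w * f = 1.

Lemma prime_dvd_fact (p m : nat) : prime p -> (p %| m`!)%N = (p <= m)%N.
Proof.
move=> p_prime; elim: m => [|m IH].
  by rewrite fact0 dvdn1 leqn0; case: p p_prime => [|[]].
rewrite factS Euclid_dvdM // IH; apply/orP/idP => [[/dvdn_leq -> //|/leqW//]|].
by rewrite leq_eqVlt => /orP[/eqP ->|]; [left|right].
Qed.

Lemma coef_f_bound : exists F : nat, forall i, `|f`_i| <= F%:Z.
Proof.
exists (\sum_(i < n.+1) absz (f`_i)%R)%N => i.
have [iln|ni] := ltnP i n.+1; last by rewrite nth_default ?szf // normr0.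
by rewrite (bigD1 (Ordinal iln)) //= PoszD -abszE lerDl.
Qed.

(** Union bound over the pairs (p, i) such that the i-th prime ideal above p contains
    both x_c and x_d, split according to whether p <= T; see the overview. *)
Lemma coprime_pairs (L : nat) : let M := ((16 * n)`!)%N in
  exists T0, forall T, (T0 <= T)%N ->
    (T ^ (n + n) <= 2 * #|[pred cd : box T * box T |
       `[< unimodular (box_point M L cd.1) (box_point M L cd.2) >]]|)%N.
Proof.
(* The primes p with p0 < p <= T exclude at most 4 n T^(2n) / p0 = T^(2n) / 4 pairs in total. *)
move=> M; pose p0 := (16 * n)%N.
have [F fF] := coef_f_bound.
(* C1 T bounds the coefficients of f and of x_c, and C T^(2n) bounds m_c. *)
pose C1 := (1 + M * (L + 1) + F)%N; pose C := (((n.*2)`!) * C1 ^ n.*2)%N.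
have /choice[Z ZP] : forall p : nat, exists Z : 'I_n -> pred {poly int}, prime p ->
  [/\ forall i, Z i f,
      forall i a b, Z i a -> Z i b -> Z i (a - b),
      forall i u a, Z i a -> Z i (u * a),
      forall i (m : int), Z i m%:P = (p %| m)%Z
    & forall a b, (forall i, ~~ (Z i a && Z i b)) ->
      exists u v w z, u * a + v * b + w * f + z * (p%:Z)%:P = 1].
  move=> p; have [/(prime_ideals_above mon_f szf)[Z HZ]|] := boolP (prime p); first by exists Z.
  by exists (fun _ _ => false).
exists (maxn 1 (maxn C.+1 (8 * n * n))) => T; rewrite !geq_max => /and3P[T0 TC Tn].
pose x (c : box T) := box_point M L c.
have /choice[m mP] : forall c : box T, exists m : nat, exists g w : {poly int}, [/\ (0 < m)%N,
    g * f + w * x c = (m%:Z)%:P & (m <= C * T ^ n.*2)%N].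
  move=> c; have [|||||||||m [g [w [m0 E mW]]]] := @small_integer_in_ideal f (x c) n (C1 * T)%N%:Z.
  - exact: mon_f.
  - exact: szf.
  - by [].
  - exact: size_box_point.
  - exact: box_point_neq0.
  - apply: cop_f; first by rewrite size_map_inj_poly ?size_box_point //; apply: intr_inj.
    by rewrite map_poly_eq0_id0 ?box_point_neq0 // intr_eq0 lead_coef_eq0 box_point_neq0.
  - by move=> i; apply: le_trans (fF i) _; rewrite lez_nat /C1; nia.
  - move=> i; have /andP[h1 h2] := coef_box_point M L c i.
    by rewrite ger0_norm //; apply: le_trans h2 _; rewrite -PoszD lez_nat /C1; nia.
  - by rewrite lez_nat /C1; nia.
  exists m, g, w; split => //; move: mW.
  by rewrite /C -mulnA -expnMn -!natz -natrX -natrM ler_nat.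
pose bad (cd : box T * box T) := ~~ `[< unimodular (x cd.1) (x cd.2) >].
pose P1 p := (p0 < p)%N && prime p.
have bad_le (c d : box T) : (bad (c, d) <=
    \sum_(p < T.+1 | P1 p) \sum_(i < n) (Z p i (x c) * Z p i (x d)) +
    \sum_(p <- primes (m c) | T < p) \sum_(i < n) (P1 p * Z p i (x d)))%N.
  rewrite /bad; case: asboolP => //= nuni.
  have [g [w [m0 E _]]] := mP c.
  have [p [p_prime pm [i /andP[Zc Zd]]]] : exists p, [/\ prime p, (p %| m c)%N &
     exists i, Z p i (x c) && Z p i (x d)].
    apply: contrapT => H; apply: nuni; apply: (unit_ideal_of_primes m0 E) => p p_prime pm.
    have [_ _ _ _] := ZP p p_prime; apply => i; apply/negP => h.
    by apply: H; exists p; split => //; exists i.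
  have [Zf ZB ZM ZC _] := ZP p p_prime.
  have p0p : (p0 < p)%N.
    rewrite ltnNge; apply/negP => pp0.
    have : Z p i 1.
      have -> : 1 = x c - (((L * T)%N%:Z)%:P + box_poly c) * (M%:Z)%:P by rewrite /x /box_point; ring.
      by apply: ZB => //; apply: (ZM); rewrite ZC dvdzE /= prime_dvd_fact.
    rewrite -polyC1 ZC dvdzE /= dvdn1 => /eqP p1; by rewrite p1 in p_prime.
  have P1p : P1 p by rewrite /P1 p0p.
  have [pT|Tp] := leqP p T.
    apply: leq_trans (leq_addr _ _); rewrite (bigD1 (Ordinal (pT : p < T.+1)%N)) //=.
    by rewrite (bigD1 i) //= Zc Zd -!addnA leq_addr.
  apply: leq_trans (leq_addl _ _).
  have pin : p \in primes (m c) by rewrite mem_primes p_prime m0.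
  by rewrite (big_rem p) //= Tp (bigD1 i) //= P1p Zd -!addnA leq_addr.
have cardZ p i : P1 p -> (\sum_(c : box T) Z p i (x c) <= T ^ n' * (T %/ p).+1)%N.
  case/andP => p0p p_prime; have [Zf ZB ZM ZC _] := ZP p p_prime.
  have := @card_box_ideal (Z p i) p M L T (ZB i) (ZM i) (ZC i) p_prime _.
  rewrite prime_dvd_fact // -ltnNge => /(_ p0p); rewrite -sum1_card big_mkcond /=.
  by move=> h; apply: leq_trans h; apply: leq_sum => c _; rewrite inE; case: (Z p i _).
have bad1 : (4 * \sum_(c : box T) \sum_(d : box T)
     \sum_(p < T.+1 | P1 p) \sum_(i < n) (Z p i (x c) * Z p i (x d)) <= T ^ (n + n))%N.
  have -> : (\sum_(c : box T) \sum_(d : box T)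
     \sum_(p < T.+1 | P1 p) \sum_(i < n) (Z p i (x c) * Z p i (x d)) =
     \sum_(p < T.+1 | P1 p) \sum_(i < n) (\sum_(c : box T) Z p i (x c)) ^ 2)%N.
    under eq_bigr do rewrite exchange_big /=.
    rewrite exchange_big /=; apply: eq_bigr => p _.
    under eq_bigr do rewrite exchange_big /=.
    rewrite exchange_big /=; apply: eq_bigr => i _.
    rewrite -mulnn big_distrl /=; apply: eq_bigr => c _; rewrite big_distrr //=.
  rewrite -(ler_nat rat) natrM natr_sum.
  have le1 (p : 'I_T.+1) : P1 p -> ((\sum_(i < n) (\sum_(c : box T) Z p i (x c)) ^ 2)%N%:R : rat)
       <= (4 * n * T ^ (n + n))%N%:R * p%:R ^- 2.
    move=> P1p; have pgt0 : (0 < p)%N by case/andP: P1p => _ /prime_gt0.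
    rewrite ler_pdivlMr ?exprn_gt0 ?ltr0n // -natrX -natrM ler_nat.
    apply: (@leq_trans (n * (T ^ n' * (T %/ p).+1) ^ 2 * p ^ 2)).
      rewrite leq_mul2r -[X in (_ <= X * _)%N](card_ord n) -sum_nat_const leq_sum ?orbT // => i _.
      by rewrite leq_exp2r // cardZ.
    rewrite -mulnA -expnMn -mulnA.
    have h : ((T %/ p).+1 * p <= 2 * T)%N.
      by rewrite mulSn mul2n -addnn leq_add ?leq_divM // -ltnS.
    apply: (@leq_trans (n * (T ^ n' * (2 * T)) ^ 2)).
      by rewrite leq_mul2l leq_exp2r // leq_mul2l h !orbT.
    rewrite addnn -muln2 expnM mulnCA expnMn -expnSr; lia.
  apply: le_trans (ler_wpM2l _ (ler_sum _ le1)) _ => //.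
  rewrite -big_distrr /=.
  have le2 : \sum_(p < T.+1 | P1 p) (p%:R ^- 2 : rat) <= p0%:R^-1.
    have [Tp0|p0T] := leqP T p0.
      rewrite big1 ?invr_ge0 // => p /andP[p0p _].
      by have := ltn_ord p; rewrite ltnS leqNgt (leq_ltn_trans Tp0 p0p).
    have := @sum_inv_sqr p0 T isT (ltnW p0T) => /le_trans H.
    apply: le_trans (H p0%:R^-1 _); last by rewrite lerBlDr lerDl invr_ge0.
    rewrite big_mkcond [X in _ <= X]big_mkcond; apply: ler_sum => p _.
    by rewrite /P1; case: (p0 < p)%N => //=; case: ifP => // _; rewrite invr_ge0 exprn_ge0.
  apply: le_trans (_ : 4 * ((4 * n * T ^ (n + n))%N%:R * p0%:R^-1) <= _).
    by rewrite ler_wpM2l // ler_wpM2l.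
  rewrite mulrA ler_pdivrMr ?ltr0n // -!natrM ler_nat /p0; lia.
have bad2 : (4 * \sum_(c : box T) \sum_(d : box T)
    \sum_(p <- primes (m c) | T < p) \sum_(i < n) (P1 p * Z p i (x d)) <= T ^ (n + n))%N.
  have le1 (c : box T) : (\sum_(d : box T)
     \sum_(p <- primes (m c) | T < p) \sum_(i < n) (P1 p * Z p i (x d)) <= 2 * n * n * T ^ n')%N.
    rewrite exchange_big /=.
    have m0 : (0 < m c)%N by have [g [w []]] := mP c.
    have cnt : (count (fun p => T < p)%N (primes (m c)) <= n.*2)%N.
      rewrite -ltnS -(@ltn_exp2l T); last first.
        by apply: leq_trans TC; rewrite ltnS muln_gt0 fact_gt0 expn_gt0.
      apply: leq_ltn_trans (large_primes_count T m0) _.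
      have [g [w [_ _ mc]]] := mP c; apply: leq_ltn_trans mc _.
      by rewrite expnS ltn_pmul2r // expn_gt0 T0.
    apply: (@leq_trans (\sum_(p <- primes (m c) | (T < p)%N) n * T ^ n')).
      rewrite leq_sum // => p Tp; rewrite exchange_big /=.
      rewrite -[X in (_ <= X * _)%N](card_ord n) -sum_nat_const leq_sum // => i _.
      rewrite -big_distrr /=; case P1p: (P1 p); rewrite ?mul0n // mul1n.
      by apply: leq_trans (cardZ p i P1p) _; rewrite divn_small // muln1.
    rewrite big_const_seq iter_addn_0; apply: leq_trans (leq_mul (leqnn _) cnt) _.
    by rewrite -muln2; lia.
  apply: (@leq_trans (4 * (T ^ n * (2 * n * n * T ^ n')))).
    by rewrite leq_mul2l /= -(card_box T) -sum_nat_const leq_sum.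
  by rewrite expnD [X in (_ <= _ * X)%N]expnS; nia.
set good := [pred cd : box T * box T | _].
have cardT : (#|good| + #|[predC good]| = T ^ (n + n))%N.
  by rewrite cardC card_prod card_box expnD.
have cardB : (#|[predC good]| <= \sum_(c : box T) \sum_(d : box T)
    \sum_(p < T.+1 | P1 p) \sum_(i < n) (Z p i (x c) * Z p i (x d)) +
    \sum_(c : box T) \sum_(d : box T)
     \sum_(p <- primes (m c) | T < p) \sum_(i < n) (P1 p * Z p i (x d)))%N.
  rewrite -big_split /= -sum1_card big_mkcond /=.
  under [X in (_ <= X)%N]eq_bigr do rewrite -big_split /=.
  rewrite pair_bigA /=; apply: leq_sum => -[c d] _.
  by apply: leq_trans (bad_le c d); rewrite inE /bad; case: (~~ _).
move: bad1 bad2 cardB cardT; move: (T ^ _)%N #|good| #|_| => u g b.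
set B1 := (\sum_c _)%N; set B2 := (\sum_c _)%N.
by move: B1 B2 => b1 b2; lia.
Qed.
End CoprimePairs.

(** * Lower bound for the number of points of bounded height *)

Section LowerBound.
Variables (R : realType) (K : fieldExtType rat) (theta : K) (f : {poly int}) (n' : nat).
Hypothesis gen : integral_power_basis theta f.
Local Notation n := (\dim {:K}).
Hypothesis nE : n = n'.+1.
Variable s : 'I_n -> {rmorphism K -> R[i]}.
Hypothesis s_inj : injective (fun j => s j theta).
Hypothesis s_conj : forall j, exists j', forall x, s j' x = (s j x)^*%C.

Definition Zeval : {rmorphism {poly int} -> K} := horner_alg theta \o map_poly intr.

Lemma Zeval_const (m : int) : Zeval m%:P = m%:~R.
Proof. by rewrite /= map_polyC horner_algC /= scaler_int. Qed.

(** Z[theta] consists of algebraic integers since f is monic. *)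
Lemma Zeval_integral (a : {poly int}) : ring_of_integers K (Zeval a).
Proof.
have ZevalE b : Zeval b = (map_poly (intr : int -> K) b).[theta].
  rewrite /= /horner_alg /horner_morph -map_poly_comp; congr (_.[_]).
  by apply: eq_map_poly => m /=; rewrite scaler_int.
have [mon_f _ f0 _ _] := gen.
rewrite ZevalE; apply: (@integral_horner_root _ _ (intr : {rmorphism int -> K}) theta (map_poly intr f)).
- exact: monic_map.
- by apply/rootP; rewrite -ZevalE.
- by apply/integral_poly => i; rewrite coef_map; apply: integral_id.
- by apply/integral_poly => i; rewrite coef_map; apply: integral_id.
Qed.

Lemma Zeval_inj (a b : {poly int}) : (size a <= n)%N -> (size b <= n)%N -> Zeval a = Zeval b -> a = b.
Proof.
move=> sa sb /eqP; rewrite -subr_eq0 -rmorphB /= => /eqP ab.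
have [_ _ _ free _] := gen; apply/eqP; rewrite -subr_eq0; apply/eqP.
have := free _ _ ab; rewrite size_map_int => H.
apply: (map_inj_poly (@intr_inj rat)); rewrite ?rmorph0 ?H //.
by rewrite (leq_trans (size_polyD _ _)) // geq_max sa size_polyN sb.
Qed.

Lemma conj_Zeval_le : exists2 C : R, 0 <= C & forall (a : {poly int}) (T : R), (size a <= n)%N ->
  (forall i, `|(a`_i)%:~R| <= T) -> forall j, cabs (s j (Zeval a)) <= C * T.
Proof.
pose B : R := \sum_(j < n) \sum_(i < n) cabs (s j theta) ^+ i.
have Bj j : 0 <= \sum_(i < n) cabs (s j theta) ^+ i.
  by apply: sumr_ge0 => i _; rewrite exprn_ge0 // cabs_ge0.
exists B => [|a T sa aT j]; first exact: sumr_ge0.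
rewrite /= conj_horner_alg ?size_map_int //; apply: le_trans (cabs_sum _ _ _) _.
apply: (@le_trans _ _ (\sum_(i < n) T * cabs (s j theta) ^+ i)).
  apply: ler_sum => i _; rewrite Normc.normcM cabsX ler_wpM2r ?exprn_ge0 ?cabs_ge0 //.
  by rewrite coef_map /= ratr_int cabs_int.
rewrite -big_distrr /= mulrC ler_wpM2r //.
  by apply: le_trans (aT 0).
exact: term_le_sum.
Qed.

Lemma Zeval_box_point M L T (c : box n' T) :
  Zeval (box_point M L c) = 1 + M%:R * ((L * T)%N%:R + Zeval (box_poly c)).
Proof.
by rewrite /box_point rmorphD rmorph1 rmorphM rmorphD !Zeval_const !pmulrn.
Qed.

Lemma conj_box_poly_le : exists2 C : R, 0 <= C & forall T (c d : box n' T) j,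
   cabs (s j (Zeval (box_poly c))) <= C * T%:R /\
   cabs (s j (Zeval (box_poly c) - Zeval (box_poly d))) <= C * T%:R.
Proof.
have [C C0 HC] := conj_Zeval_le; exists C => // T c d j.
have sz (e : box n' T) : (size (box_poly e) <= n)%N by rewrite nE size_poly.
have co (e : box n' T) i : 0 <= (box_poly e)`_i <= T%:Z.
  by rewrite coef_poly; case: ifP => [_|_]; [rewrite !lez_nat /= ltnW ?ltn_ord //|rewrite lexx lez_nat //].
split; first apply: HC => // i.
  have /andP[h1 h2] := co c i.
  by rewrite -intr_norm ger0_norm // pmulrn ler_int.
rewrite -rmorphB; apply: HC.
  by rewrite (leq_trans (size_polyD _ _)) // geq_max size_polyN !sz.
move=> i; rewrite coefB -intr_norm pmulrn ler_int.
have := co c i; have := co d i; move: (_`_i) (_`_i) => u v; lia.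
Qed.

(** Choice of L: the second inequality says that two elements of the box differ, at
    each embedding, by less than their size, so that their ratio is within 1 of 1. *)
Lemma box_point_bounds (M : nat) : (0 < M)%N -> exists (L : nat) (C : R), 1 <= C /\
  forall T (c d : box n' T) j, (0 < T)%N ->
   cabs (s j (Zeval (box_point M L c))) <= C * T%:R /\
   cabs (s j (Zeval (box_point M L d) - Zeval (box_point M L c))) < cabs (s j (Zeval (box_point M L c))).
Proof.
move=> M0; have [C C0 HC] := conj_box_poly_le.
(* L > 2 C + 2 leaves room for M C T twice and for the term 1. *)
have [L L1] : exists L : nat, 2 * C + 2 < L%:R.
  by exists (Num.truncn (2 * C + 2)).+1; apply: truncnS_gt.
exists L, (1 + M%:R * (L%:R + C)).
have M1 : 1 <= M%:R :> R by rewrite ler1n.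
split; first by rewrite lerDl mulr_ge0 // addr_ge0.
move=> T c d j T0; have T1 : 1 <= T%:R :> R by rewrite ler1n.
have [h1 _] := HC T c d j; have [_ h2] := HC T d c j.
have -> : Zeval (box_point M L d) - Zeval (box_point M L c) =
   M%:R * (Zeval (box_poly d) - Zeval (box_poly c)) by rewrite !Zeval_box_point; ring.
rewrite Zeval_box_point.
move: h2; move: (Zeval (box_poly d) - _) => z h2.
move: h1; move: (Zeval (box_poly c)) => y0 h1; set y := s j y0 in h1 *.
have cabs_nat (k : nat) : cabs (k%:R : R[i]) = k%:R.
  by rewrite -[k%:R]/(k%:Z%:~R) cabs_int ger0_norm // ler0z.
rewrite !(rmorphD, rmorphM, rmorph_nat, rmorph1) /= -/y -?natrM.
split.
  apply: le_trans (cabsD _ _) _; rewrite Normc.normc1 Normc.normcM cabs_nat.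
  apply: (@le_trans _ _ (1 + M%:R * ((L * T)%N%:R + C * T%:R))).
    rewrite lerD2l ler_wpM2l //; apply: le_trans (cabsD _ _) _.
    by rewrite cabs_nat lerD2l.
  rewrite natrM -mulrDl mulrA mulrDl mul1r lerD2r //.
rewrite Normc.normcM cabs_nat.
have h3 : cabs (M%:R * (L * T)%N%:R : R[i]) <= 
    cabs (1 + M%:R * ((L * T)%N%:R + y)) + (cabs (1 : R[i]) + cabs (M%:R * y)).
  have -> : M%:R * (L * T)%N%:R = (1 + M%:R * ((L * T)%N%:R + y)) - (1 + M%:R * y) :> R[i] by ring.
  apply: le_trans (cabsD _ _) _; rewrite cabsN lerD2l; exact: cabsD.
rewrite !Normc.normcM Normc.normc1 !cabs_nat natrM in h3.
have h4 : M%:R * cabs y <= M%:R * (C * T%:R) by rewrite ler_wpM2l.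
have h5 : M%:R * cabs (s j z) <= M%:R * (C * T%:R) by rewrite ler_wpM2l.
suff h6 : M%:R * (C * T%:R) + M%:R * (C * T%:R) + 1 < M%:R * (L%:R * T%:R) :> R.
  move: h3 h4 h5 h6; move: (cabs (1 + _)) => u1.
  move: (M%:R * cabs (s j z)) (M%:R * cabs y) => u2 u3.
  by move: (M%:R * (C * T%:R)) (M%:R * (L%:R * T%:R)) => u4 u5; lra.
have h7 : 1 <= M%:R * T%:R :> R by rewrite mulr_ege1.
have -> : M%:R * (L%:R * T%:R) = M%:R * T%:R * L%:R :> R by ring.
have -> : M%:R * (C * T%:R) + M%:R * (C * T%:R) + 1 = M%:R * T%:R * (2 * C) + 1 :> R by ring.
move: h7; move: (M%:R * T%:R) => w h7; apply: (@lt_le_trans _ _ (w * (2 * C + 2))).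
  by rewrite mulrDr ltrD2l; lra.
by rewrite ler_wpM2l ?ltW // (lt_le_trans _ h7).
Qed.

Lemma box_point_inj M L T : (0 < M)%N -> injective (@box_point n' M L T).
Proof.
move=> M0 c d E; apply/ffunP => i; apply: val_inj; apply/eqP; rewrite -eqz_nat.
have nz : (M%:Z)%:P != 0 :> {poly int} by rewrite polyC_eq0 eqz_nat -lt0n.
have bE : box_poly c = box_poly d by move/addrI/(mulfI nz)/addrI: E.
by rewrite -!coef_box_poly bE.
Qed.

(** The points [x_c : x_d : x_(e_0) : x_(e_1) : ...] with (c, d) unimodular and e
    arbitrary are pairwise distinct.  If k is the ratio of two proportional tuples,
    unimodularity gives k in Z[theta], and k - 1 has all conjugates less than 1. *)
Lemma counting_Omega_ge_pairs (N' M L T : nat) (C B : R) : (0 < M)%N -> (0 < T)%N -> 1 <= C ->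
  (forall (c d : box n' T) j,
   cabs (s j (Zeval (box_point M L c))) <= C * T%:R /\
   cabs (s j (Zeval (box_point M L d) - Zeval (box_point M L c))) < cabs (s j (Zeval (box_point M L c)))) ->
  (C * T%:R) ^+ n <= B ->
  ((#|[pred cd : box n' T * box n' T |
       `[< unimodular f (box_point M L cd.1) (box_point M L cd.2) >]]| * (T ^ n'.+1) ^ N')%N%:R%:E
    <= counting (Omega K N'.+1 B) :> \bar R)%E.
Proof.
move=> M0 T0 C1 HC TB; set good := [pred cd | _].
pose X (c : box n' T) := Zeval (box_point M L c).
(* The row (x_c, x_d, x_(e_0), x_(e_1), ...). *)
pose pick (c d : box n' T) (e : {ffun 'I_N' -> box n' T}) (i : 'I_N'.+2) : box n' T :=
  if unlift ord0 i is Some i1 then (if unlift ord0 i1 is Some i2 then e i2 else d) else c.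
pose I : finType := ({cd | good cd} * {ffun 'I_N' -> box n' T})%type.
pose row c d e : 'rV[K]_N'.+2 := \row_i X (pick c d e i).
pose phi (x : I) := proj_point (row (val x.1).1 (val x.1).2 x.2).
have cardI : #|I| = (#|good| * (T ^ n'.+1) ^ N')%N.
  by rewrite card_prod card_sig card_ffun card_box card_ord.
rewrite -cardI.
have X0 c : X c != 0.
  apply/eqP => Xc; have n0 : (0 < n)%N by apply: dim_gt0.
  have [_] := HC c c (Ordinal n0).
  by rewrite -/(X c) Xc subrr rmorph0 Normc.normc0 ltxx.
have row0 c d e : row c d e 0 ord0 = X c by rewrite mxE /pick unlift_none.
have row1 c d e : row c d e 0 (lift ord0 ord0) = X d.
  by rewrite mxE /pick liftK unlift_none.
have row2 c d e i : row c d e 0 (lift ord0 (lift ord0 i)) = X (e i).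
  by rewrite mxE /pick !liftK.
have T1 : 1 <= C * T%:R by rewrite mulr_ege1 // ler1n.
apply: (@counting_inj_ge R _ I phi) => [[[[c d] /= g] e] [[[c' d'] /= g'] e']|[[[c d] /= g] e]]; last first.
  exists (row c d e) => //; split.
    by apply/eqP => /matrixP/(_ 0 ord0); rewrite row0 mxE => /eqP; rewrite (negPf (X0 c)).
  apply: le_trans TB; apply: (height_le gen s_inj s_conj) => // i.
    by rewrite mxE; apply: Zeval_integral.
  by move=> j; rewrite mxE; case: (HC (pick c d e i) c j).
rewrite /phi /= => E.
have : row c' d' e' \in proj_point (row c d e) by rewrite E /proj_point memv_line.
case/vlineP => k kE.
have rk i : row c' d' e' 0 i = k * row c d e 0 i by rewrite kE mxE.
have k0 : X c' = k * X c by have := rk ord0; rewrite !row0.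
have k1 : X d' = k * X d by have := rk (lift ord0 ord0); rewrite !row1.
have f0 : Zeval f = 0 by case: gen.
(* 1 = u x_c + v x_d gives k = u x_c' + v x_d'. *)
have kint : ring_of_integers K k.
  move/asboolP: (g) => [u [v [w /(congr1 Zeval)]]]; rewrite rmorph1 !rmorphD !rmorphM f0.
  rewrite mulr0 addr0 -/(X c) -/(X d) => uv.
  have -> : k = Zeval (u * box_point M L c' + v * box_point M L d').
    by rewrite rmorphD !rmorphM -/(X c') -/(X d') k0 k1 -[LHS]mulr1 -uv; ring.
  exact: Zeval_integral.
have : k - 1 = 0.
  apply: (integral_conj_lt1_eq0 gen s_inj) => [|j].
    apply: ring_of_integersB => //.
    exact: (mxpoly.integral1 (intr : {rmorphism int -> K})).
  have [_] := HC c c' j; rewrite -/(X c) -/(X c') k0 -{2}[X c]mul1r -mulrBl rmorphM Normc.normcM.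
  by rewrite -[X in _ < X]mul1r ltr_pM2r // lt_neqAle cabs_ge0 eq_sym cabs_eq0 fmorph_eq0 X0.
move/eqP; rewrite subr_eq0 => /eqP kone.
have inj c1 c2 : X c1 = X c2 -> c1 = c2.
  move=> XX; apply: (@box_point_inj M L T M0); apply: Zeval_inj XX;
  by rewrite nE size_box_point.
have cc : c = c' by apply: inj; rewrite k0 kone mul1r.
have dd : d = d' by apply: inj; rewrite k1 kone mul1r.
have ee : e = e'.
  by apply/ffunP => i; apply: inj; have := rk (lift ord0 (lift ord0 i)); rewrite !row2 kone mul1r.
by subst; congr (_, _); apply: val_inj.
Qed.

(** Apply [counting_Omega_ge_pairs] with T of order B^(1/n). *)
Lemma counting_Omega_ge N : (0 < N)%N -> exists2 c : R, 0 < c &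
  exists B0 : R, forall B : R, B0 <= B -> ((c * B ^+ N.+1)%:E <= counting (Omega K N B))%E.
Proof.
case: N => // N' _; have [mon_f szf _ _ _] := gen.
have cop (a : {poly rat}) : (size a <= n'.+1)%N -> a != 0 -> coprimep (map_poly intr f) a.
  by rewrite -nE; apply: (coprime_generator_poly gen).
rewrite nE in szf.
have := coprime_pairs mon_f szf cop; set M := ((16 * n'.+1)`!)%N => HT.
have M0 : (0 < M)%N by apply: fact_gt0.
clearbody M.
have [L [C [C1 HC]]] := box_point_bounds M0.
have [T0 {}HT] := HT L.
have C0 : 0 < C by apply: lt_le_trans C1.
pose T1 := maxn 2 T0; have n0 : (0 < n)%N by apply: dim_gt0.
have D0 : 0 < (2 * C) ^+ n by rewrite exprn_gt0 // mulr_gt0.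
exists (((2 * C) ^+ n) ^- N'.+2 / 2).
  by rewrite divr_gt0 // invr_gt0 exprn_gt0.
exists ((C * T1%:R) ^+ n) => B BB.
have CT1 : 0 <= C * T1%:R by rewrite mulr_ge0 // ltW.
have B0 : 0 <= B by apply: le_trans BB; rewrite exprn_ge0.
pose b := B `^ (n%:R^-1).
have b0 : 0 <= b by apply: powR_ge0.
have bn : b ^+ n = B.
  by rewrite -powR_mulrn // /b -powRrM mulVf ?pnatr_eq0 -?lt0n // powRr1.
have bT1 : C * T1%:R <= b by rewrite -(@ler_pXn2r _ n) ?nnegrE // bn.
have bC0 : 0 <= b / C by rewrite divr_ge0 // ltW.
(* T >= b / (2 C) because T >= 2, and (C T)^n <= b^n = B. *)
pose T := Num.truncn (b / C).
have TT1 : (T1 <= T)%N by rewrite truncn_ge_nat // ler_pdivlMr // mulrC.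
have Tle : T%:R <= b / C by rewrite truncn_le.
have Tge : b / C < T%:R + 1 by rewrite natr1; apply: truncnS_gt.
have T2 : 2 <= T%:R :> R by rewrite (ler_nat R 2); apply: leq_trans TT1; apply: leq_maxl.
have Tpos : (0 < T)%N by rewrite -(ltr_nat R); apply: lt_le_trans T2.
have TB : (C * T%:R) ^+ n <= B.
  have CTb : C * T%:R <= b by rewrite mulrC -ler_pdivlMr.
  by rewrite -bn; apply: lerXn2r => //; rewrite nnegrE mulr_ge0 // ltW.
have := @counting_Omega_ge_pairs N' M L T C B M0 Tpos C1 (fun c d j => HC T c d j Tpos) TB.
apply: le_trans; rewrite lee_fin.
have := HT T (leq_trans (leq_maxr _ _) TT1).
set g := #|_| => Hg.
have {}Hg : (T ^ (n * N'.+2) <= 2 * (g * (T ^ n'.+1) ^ N'))%N.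
  rewrite mulnA; apply: leq_trans (leq_mul Hg (leqnn _)).
  by rewrite -expnM -expnD nE !mulnS addnA.
rewrite -(ler_nat R) natrM natrX exprM in Hg.
apply: (@le_trans _ _ ((T%:R ^+ n) ^+ N'.+2 / 2)); last by rewrite ler_pdivrMr // mulrC.
rewrite mulrAC ler_pM2r ?invr_gt0 // -exprVn -exprMn; apply: lerXn2r.
- by rewrite nnegrE mulr_ge0 // invr_ge0 ltW.
- by rewrite nnegrE exprn_ge0.
rewrite mulrC ler_pdivrMr // -bn -exprMn; apply: lerXn2r; rewrite ?nnegrE ?mulr_ge0 ?(ltW C0) //.
have : b < (T%:R + 1) * C by rewrite -ltr_pdivrMr.
move: T2; move: (T%:R : R) => t t2 bt; apply: le_trans (ltW bt) _.
by rewrite mulrA ler_pM2r // mulr_natr mulr2n lerD2l (le_trans _ t2) // ler1n.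
Qed.

End LowerBound.

(** * The class number and the final estimate *)

Lemma counting_bigcup_le (R : realType) (T : choiceType) (h : nat) (A : 'I_h -> set T) (M : R) :
  (forall i, (counting (A i) <= M%:E)%E) ->
  (counting (\bigcup_(i in [set: 'I_h]) A i) <= (h%:R * M)%:E)%E.
Proof.
move=> AM.
have finA i : finite_set (A i) /\ (#|` fset_set (A i)|)%:R <= M.
  by have := AM i; rewrite /counting; case: asboolP => // finAi; rewrite lee_fin.
have [S uS SA|finU cU] := @finite_of_size_le R _ (\bigcup_(i in [set: 'I_h]) A i) (h%:R * M);
  last by rewrite /counting asboolT // lee_fin.
apply: (@le_trans _ _ (\sum_(i < h) (#|` fset_set (A i)|)%:R)); last first.
  have -> : h%:R * M = \sum_(i < h) M by rewrite sumr_const card_ord mulr_natl.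
  by apply: ler_sum => i _; case: (finA i).
rewrite -natr_sum ler_nat.
apply: (@leq_trans (size (flatten [seq (fset_set (A i) : seq T) | i <- enum 'I_h]))).
  apply: uniq_leq_size => // x /SA[i _ Ax]; apply/flattenP.
  exists (fset_set (A i) : seq T); first by apply/mapP; exists i; rewrite ?mem_enum.
  by rewrite in_fset_set ?mem_set //; case: (finA i).
rewrite size_flatten /shape -map_comp sumnE big_map big_enum /=.
by apply: leq_sum => i _.
Qed.

Lemma ideal_equiv_cancel (K : fieldExtType rat) (a b c : set K) :
  ideal_equiv a c -> ideal_equiv b c -> ideal_equiv a b.
Proof.
move=> [x x0 ->] [y y0 /seteqP[E1 E2]]; exists (x / y); first by rewrite mulf_neq0 ?invr_neq0.
apply/seteqP; split => z.
  move=> bz; have [w aw ww] := E2 (y * z) (ex_intro2 _ _ z bz erefl).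
  by exists w => //; rewrite mulrAC ww mulrAC mulfV // mul1r.
case=> w aw <-; have [z' bz' ww] := E1 (x * w) (ex_intro2 _ _ w aw erefl).
by rewrite mulrAC -ww mulrAC mulfV // mul1r.
Qed.

(** Sending an ideal to the representative of its class in the other family is
    injective. *)
Lemma class_reps_number_le (K : fieldExtType rat) (h h0 : nat) (a : 'I_h -> set K) (a0 : 'I_h0 -> set K) :
  ideal_class_reps a -> ideal_class_reps a0 -> (h <= h0)%N.
Proof.
case=> aI a_inj _ [_ _ a0_surj].
have /choice[phi phiP] := fun i => a0_surj (a i) (aI i).
rewrite -(card_ord h) -(card_ord h0); apply: (@leq_card _ _ phi) => i j ij.
apply: a_inj; apply: ideal_equiv_cancel (phiP i) _.
by rewrite ij; apply: phiP.
Qed.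

Theorem theorem1p1 (R : realType) (K : fieldExtType rat) (N : nat)
    (eps : 'I_(unit_rank K) -> K) :
  (0 < N)%N -> fundamental_units R eps ->
  exists k : R, forall (h : nat) (a : 'I_h -> set K), ideal_class_reps a ->
    (limf_esup (fun B : R => counting (search_space N eps a B)
                             / counting (Omega K N B)) +oo%R <= k%:E)%E.
Proof.
move=> N0 _.
have [theta [f gen]] := integral_generator K.
have [s [s_inj s_conj]] := embeddings gen R.
have nE : \dim {:K} = (\dim {:K}).-1.+1 by rewrite prednK // dim_gt0.
have [C C1 HC] := counting_search_space_ideal_le gen s_inj eps N.
have [c c0 [B1 HO]] := counting_Omega_ge gen nE s_inj s_conj N0.
have [[h0 [a0 a0P]]|no_reps] := pselect (exists h0 (a0 : 'I_h0 -> set K), ideal_class_reps a0);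
  last by exists 0 => h a aP; exfalso; apply: no_reps; exists h, a.
exists (h0%:R * C / c) => h a aP.
have hh0 : (h <= h0)%N := class_reps_number_le aP a0P.
have /choice[Ba HBa] := fun i => HC (a i) (let: And3 H _ _ := aP in H i).
pose B0 : R := \big[Num.max/Num.max 1 B1]_i Ba i.
have B0a i : Ba i <= B0 by apply: le_bigmax.
have B01 : Num.max 1 B1 <= B0 by apply: bigmax_ge_id.
apply: (@le_trans _ _ (ereal_sup [set (counting (search_space N eps a B)
     / counting (Omega K N B))%E | B in [set B : R | B0 < B]])).
  apply: ereal_inf_lbound; exists [set B : R | B0 < B] => //.
  by exists B0; split => //; apply: num_real.
apply: ge_ereal_sup => _ [B /= B0B <-].
have B1B : 1 <= B /\ B1 <= B.
  by apply/andP; rewrite -ge_max; apply: le_trans B01 (ltW B0B).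
have {}HO := HO B B1B.2.
have BN : 0 < B ^+ N.+1 by rewrite exprn_gt0 // (lt_le_trans _ B1B.1).
have HS : (counting (search_space N eps a B) <= (h%:R * (C * B ^+ N.+1))%:E)%E.
  by apply: counting_bigcup_le => i; apply: HBa; apply: le_trans (B0a i) (ltW B0B).
move: HO; case: (counting (Omega K N B)) => [r| |//].
  rewrite lee_fin => cr; have r0 : 0 < r by apply: lt_le_trans cr; rewrite mulr_gt0.
  rewrite inver gt_eqF // lee_pdivrMr // -EFinM; apply: le_trans HS _; rewrite lee_fin.
  apply: (@le_trans _ _ (h0%:R * (C * B ^+ N.+1))).
    by rewrite ler_wpM2r ?ler_nat // mulr_ge0 ?(le_trans _ C1) // ltW.
  rewrite -!mulrA ler_wpM2l // ler_wpM2l ?(le_trans _ C1) //.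
  by rewrite mulrC ler_pdivlMr // mulrC.
by move=> _; rewrite invey mule0 lee_fin divr_ge0 ?mulr_ge0 ?(ltW c0) // (le_trans _ C1).
Qed.
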